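(* Let $w$, $g$, $\{p_n\}_{n\ge0}$, $\{b_n\}_{n\ge 0}$ and $\Phi=\{\varphi_n\}_{n\ge 0}$ be as in the context, with $\Phi$ an orthonormal basis of $L_2(\mathbb{R})$, and let $\varepsilon>0$. Then the functions $$\psi_n(x,t)=\frac{\mathrm{i}^n}{\sqrt{2\pi}}\int_{-\infty}^\infty p_n(\xi)\,g(\xi)\,\mathrm{e}^{\mathrm{i}x\xi+\mathrm{i}\varepsilon t\xi^2}\,\mathrm{d}\xi,\qquad n\in\mathbb{Z}_+,$$ satisfy $$\frac{\partial\psi_n}{\partial t}=-\mathrm{i}\varepsilon\frac{\partial^2\psi_n}{\partial x^2},\qquad \psi_n(x,0)=\varphi_n(x),\quad x\in\mathbb{R},$$ and for every $t$ the system $\{\psi_n(\cdot,t)\}_{n\ge0}$ is itself an orthonormal basis of $L_2(\mathbb{R})$ satisfying $$\frac{\partial\psi_n(x,t)}{\partial x}=-b_{n-1}\psi_{n-1}(x,t)+b_n\psi_{n+1}(x,t),\qquad n\in\mathbb{Z}_+,$$ where $b_{-1}=0$, with the same constants $b_n$ (independent of $t$) as for $\Phi$, i.e. as in $\varphi_n'=-b_{n-1}\varphi_{n-1}+b_n\varphi_{n+1}$.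
   Context: $\mathbb{Z}_+=\{0,1,2,\dots\}$. $w(\xi)\,\mathrm{d}\xi$ is a Borel measure on $\mathbb{R}$ with density $w\ge0$ that is even and has all moments finite. $\{p_n\}_{n\ge0}$ is the system of real orthonormal polynomials ($\deg p_n=n$) with respect to $w(\xi)\,\mathrm{d}\xi$: $$\int p_np_m w\,\mathrm{d}\xi=0\ (m\ne n),\qquad \int p_n^2w\,\mathrm{d}\xi=1,$$ satisfying the recurrence $b_np_{n+1}(\xi)=\xi p_n(\xi)-b_{n-1}p_{n-1}(\xi)$ for $n\in\mathbb{Z}_+$, with $b_{-1}=0$ and $b_n>0$ for $n\ge0$. $g$ is any (measurable, complex-valued) function with $|g(\xi)|^2=w(\xi)$. The system $\Phi=\{\varphi_n\}_{n\ge 0}$ is $$\varphi_n(x)=\frac{\mathrm{i}^n}{\sqrt{2\pi}}\int_{-\infty}^\infty p_n(\xi)\,g(\xi)\,\mathrm{e}^{\mathrm{i}x\xi}\,\mathrm{d}\xi,\qquad n\in\mathbb{Z}_+;$$ it is orthonormal in $L_2(\mathbb{R})$ and satisfies $\varphi_n'=-b_{n-1}\varphi_{n-1}+b_n\varphi_{n+1}$. It is assumed that $\Phi$ is a (complete) orthonormal basis of $L_2(\mathbb{R})$. *)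

(* Defs.v *)
From HB Require Import structures.
From mathcomp Require Import all_boot all_order all_algebra.
From mathcomp Require Import all_classical all_reals all_analysis.
From mathcomp Require Import complex.

Set Implicit Arguments.
Unset Strict Implicit.
Unset Printing Implicit Defensive.

Import Order.TTheory GRing.Theory Num.Theory.
Import numFieldNormedType.Exports.
Import ComplexField.Normc.

Local Open Scope classical_set_scope.
Local Open Scope ring_scope.

Section ComplexValued.
Context {R : realType}.
Implicit Types (f h : R -> R[i]) (x : R).
Local Notation mu := (@lebesgue_measure R).

Definition cmeasurable f : Prop :=
  measurable_fun setT (fun x => complex.Re (f x)) /\
  measurable_fun setT (fun x => complex.Im (f x)).

(* The integral is taken componentwise; [Rintegral] returns a default value on
   functions that are not Lebesgue integrable. *)
Definition cintegral f : R[i] :=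
  Complex (\int[mu]_x complex.Re (f x)) (\int[mu]_x complex.Im (f x)).

Definition cderivable f x : Prop :=
  derivable (fun y => complex.Re (f y)) x 1 /\
  derivable (fun y => complex.Im (f y)) x 1.

Definition cderive f x : R[i] :=
  Complex (derive1 (fun y => complex.Re (f y)) x)
          (derive1 (fun y => complex.Im (f y)) x).

Definition expi (theta : R) : R[i] := Complex (cos theta) (sin theta).

Definition L2norm f : \bar R := Lnorm mu 2%:E (fun x => (normc (f x))%:E).

(* Elements of L_2(R) are represented by functions, not by classes modulo
   almost-everywhere equality. *)
Definition inL2 f : Prop := cmeasurable f /\ (L2norm f < +oo)%E.

Definition L2inner f h : R[i] := cintegral (fun x => f x * (h x)^*%C).

Definition orthonormal_basis_L2 (u : nat -> R -> R[i]) : Prop :=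
  [/\ forall n, inL2 (u n),
      forall m n, L2inner (u m) (u n) = (m == n)%:R
    & (* the finite linear combinations of the [u k] are dense in L_2(R) *)
      forall f, inL2 f -> forall e : R, 0 < e ->
        exists (N : nat) (c : nat -> R[i]),
          (L2norm (fun x => f x - \sum_(k < N) c k * u k x)%R < e%:E)%E].

End ComplexValued.

Section Systems.
Context {R : realType}.
Local Notation mu := (@lebesgue_measure R).

Definition orthonormal_polys (w : R -> R) (p : nat -> {poly R}) : Prop :=
  (forall n, size (p n) = n.+1) /\
  (forall m n,
    \int[mu]_xi ((p m).[xi] * (p n).[xi] * w xi) = (m == n)%:R :> R).

(* [coef_pred b n] is b_{n-1}, with b_{-1} = 0; the terms indexed by n - 1 below are
   written [coef_pred b n * u n.-1], so the value of [u n.-1] at n = 0 is immaterial. *)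
Definition coef_pred (b : nat -> R) (n : nat) : R := if n is m.+1 then b m else 0.

Definition three_term_recurrence (b : nat -> R) (p : nat -> {poly R}) : Prop :=
  forall n, b n *: p n.+1 = 'X * p n - coef_pred b n *: p n.-1.

Definition phi (p : nat -> {poly R}) (g : R -> R[i]) (n : nat) (x : R) : R[i] :=
  'i%C ^+ n / (Num.sqrt (2 * pi))%:C%C *
  cintegral (fun xi => ((p n).[xi])%:C%C * g xi * expi (x * xi)).

Definition psi (p : nat -> {poly R}) (g : R -> R[i]) (eps : R)
    (n : nat) (x t : R) : R[i] :=
  'i%C ^+ n / (Num.sqrt (2 * pi))%:C%C *
  cintegral (fun xi =>
    ((p n).[xi])%:C%C * g xi * expi (x * xi + eps * t * xi ^+ 2)).

End Systems.

(* Main.v *)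
Require Import Defs.
From HB Require Import structures.
From mathcomp Require Import all_boot all_order all_algebra.
From mathcomp Require Import all_classical all_reals all_analysis.
From mathcomp Require Import complex.
From mathcomp Require Import measurable_realfun ring lra.

(** The proof rests on one analytic fact: for a function that is both integrable
and square integrable, the Fourier integral is a square-integrable function, and
the map is sqrt(2 pi) times an isometry (lemma [plancherel]; by polarization
[parseval]).  Everything else is formal.

Write a_n(xi) = i^n p_n(xi) g(xi) / sqrt(2 pi), so that phi_n is the Fourier
integral of a_n, and E_t(xi) = exp(i eps t xi^2), so that psi_n(., t) is the
Fourier integral of a_n E_t.

- The products q g with q a polynomial are integrable and square integrable,
  because w has all its moments ([cL1L2_polyg]).  This justifies differentiating
  under the integral sign: d/dx multiplies the integrand by i xi, and d/dt by
  i eps xi^2.  As (i xi)^2 = - xi^2, the evolution equation holds; and the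
  three-term recurrence for xi p_n becomes the recurrence for the x-derivative,
  the signs coming from i * i^n = i^(n+1) = - i^(n-1).

- The chirp E_t has modulus one, so it disappears from a_m E_t * conj (a_n E_t).
  Hence Parseval reduces the orthonormality of the psi_n(., t) to that of the p_n
  with respect to w ([psi_orthonormal]).

- Completeness ([psi_complete]) is transported from time 0 to time t without
  inverting the Fourier transform.  Approximate a square-integrable f by the
  transform of h, a combination of the a_n, using completeness of the phi_n.
  Apply completeness a second time, to the transform of h * conj E_t: it is close
  to the transform of some combination s of the a_n.  By Plancherel h * conj E_t
  is then close to s, hence h is close to s E_t, hence the transform of h is close
  to that of s E_t, which is a combination of the psi_n(., t).

For Plancherel's theorem, let f be real, with cosine and sine transforms C and S.
Multiplying C^2 + S^2 by exp(- d |x|) and integrating gives, by Fubini, twice the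
quadratic form of f with the Poisson kernel d / (d^2 + (xi - eta)^2), whose total
mass is pi ([abel_energy]).  The inequality f(xi) f(eta) <= (f(xi)^2 + f(eta)^2) / 2
bounds this form by pi times the integral of f^2; letting d tend to 0 gives one
inequality of Plancherel ([energy_integral_le]).  If f is bounded, vanishes outside
a bounded open interval and is continuous inside it, then the Poisson means of f
converge to pi f inside it and the form converges to pi times the integral of f^2,
so that equality holds ([real_isometric_continuous_itv]).  The inequality makes the
set of functions with equality closed in mean square ([real_isometric_closed]), and
truncation together with the density of continuous functions reaches every f.
A complex function is handled through its real and imaginary parts, the cross
terms being odd in x. *)

Set Implicit Arguments.
Unset Strict Implicit.
Unset Printing Implicit Defensive.

Import Order.TTheory GRing.Theory Num.Theory.
Import numFieldNormedType.Exports.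
Import ComplexField.Normc.

Local Open Scope classical_set_scope.
Local Open Scope ring_scope.

(** * Integrable real functions *)

Section Measurability.
Context {R : realType} {d} {T : measurableType d}.
Implicit Types f : T -> R.

Lemma measurable_cos_comp f : measurable_fun setT f ->
  measurable_fun setT (fun x => cos (f x)).
Proof.
by move=> mf; apply: (measurableT_comp _ mf); apply: continuous_measurable_fun;
  exact: continuous_cos.
Qed.

Lemma measurable_sin_comp f : measurable_fun setT f ->
  measurable_fun setT (fun x => sin (f x)).
Proof.
by move=> mf; apply: (measurableT_comp _ mf); apply: continuous_measurable_fun;
  exact: continuous_sin.
Qed.

End Measurability.

Section Integrability.
Context {R : realType}.
Local Notation mu := (@lebesgue_measure R).
Implicit Types f h : R -> R.

Definition L1 f := mu.-integrable setT (EFin \o f).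

Lemma L1_measurable f : L1 f -> measurable_fun setT f.
Proof. by move/integrableP => [/measurable_EFinP]. Qed.

Lemma le_L1 f h : measurable_fun setT f -> (forall x, `|f x| <= `|h x|) ->
  L1 h -> L1 f.
Proof.
move=> mf fh; apply: le_integrable => //; first exact/measurable_EFinP.
by move=> x _; rewrite /= lee_fin.
Qed.

Lemma L1Z r f : L1 f -> L1 (fun x => r * f x).
Proof. by move=> lf; exact: (@integrableZl _ _ _ mu _ measurableT r (EFin \o f) lf). Qed.

(** The product of an integrable function by a bounded one; all later
integrability claims about oscillatory integrands are instances. *)
Lemma L1M f h (M : R) : L1 f -> measurable_fun setT h -> (forall x, `|h x| <= M) ->
  L1 (fun x => f x * h x).
Proof.
move=> lf mh hM.
have lMf := L1Z M lf.
apply: le_L1 lMf; first by apply: measurable_funM => //; exact: L1_measurable.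
move=> x; rewrite !normrM mulrC ler_wpM2r// (le_trans (hM x))//.
exact: ler_norm.
Qed.

Lemma L1D f h : L1 f -> L1 h -> L1 (fun x => f x + h x).
Proof. by move=> lf lh; exact: (integrableD measurableT lf lh). Qed.

Lemma L1B f h : L1 f -> L1 h -> L1 (fun x => f x - h x).
Proof. by move=> lf lh; exact: (integrableB measurableT lf lh). Qed.

Lemma L1N f : L1 f -> L1 (fun x => - f x).
Proof. by move=> lf; exact: (integrableN lf). Qed.

Lemma eq_L1 f h : f =1 h -> L1 f -> L1 h.
Proof. by move=> /funext ->. Qed.

Lemma L1_norm f : L1 f -> L1 (fun x => `|f x|).
Proof. by move=> lf; exact: (integrable_norm lf). Qed.

Lemma continuous_cosM (s : R) : continuous (fun x : R => cos (x * s)).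
Proof.
move=> x; apply: (@continuous_comp R R R (fun x : R => x * s) (@cos R)); last exact: continuous_cos.
exact: mulrr_continuous.
Qed.

Lemma continuous_sinM (s : R) : continuous (fun x : R => sin (x * s)).
Proof.
move=> x; apply: (@continuous_comp R R R (fun x : R => x * s) (@sin R)); last exact: continuous_sin.
exact: mulrr_continuous.
Qed.

End Integrability.

(** * The Poisson kernel and its Laplace representation *)

Section PoissonKernel.
Context {R : realType}.
Local Notation mu := (@lebesgue_measure R).

Definition poisson (d s : R) := d / (d ^+ 2 + s ^+ 2).

Lemma poisson_ge0 (d s : R) : 0 < d -> 0 <= poisson d s.
Proof. by move=> d0; rewrite divr_ge0 ?addr_ge0 ?sqr_ge0// ltW. Qed.

Lemma poisson_den_gt0 (d s : R) : 0 < d -> 0 < d ^+ 2 + s ^+ 2.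
Proof. by move=> d0; rewrite ltr_pwDl ?sqr_ge0 ?exprn_gt0. Qed.

Lemma poisson_le (d s : R) : 0 < d -> poisson d s <= d^-1.
Proof.
move=> d0; rewrite ler_pdivrMr ?poisson_den_gt0// mulrDr expr2 mulKf ?gt_eqF//.
by rewrite lerDl mulr_ge0 ?sqr_ge0// invr_ge0 ltW.
Qed.

Lemma continuous_poisson (d : R) : 0 < d -> continuous (poisson d).
Proof.
move=> d0 s; apply: cvgM; first exact: cvg_cst.
apply: cvgV; first by rewrite gt_eqF ?poisson_den_gt0.
by apply: cvgD; [exact: cvg_cst|exact: exprn_continuous].
Qed.

Lemma poissonN (d s : R) : poisson d (- s) = poisson d s.
Proof. by rewrite /poisson sqrrN. Qed.

Let F (d a x : R) := atan ((x - a) / d).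

Let dF (d a x : R) : 0 < d -> is_derive x 1 (F d a) (poisson d (x - a)).
Proof.
move=> d0; rewrite /F.
have -> : poisson d (x - a) = (1 + ((x - a) / d) ^+ 2)^-1 * d^-1.
  rewrite /poisson -invfM; field.
  by rewrite !gt_eqF// ?poisson_den_gt0//.
have h : is_derive x 1 (fun x : R => (x - a) / d) d^-1.
  have -> : (fun x : R => (x - a) / d) = (fun x => d^-1 *: (x - a)).
    by apply/funext => z; rewrite /GRing.scale /= mulrC.
  apply: is_derive_eq.
  by rewrite subr0 /GRing.scale /= mulr1.
apply: is_derive_eq.
by rewrite /GRing.scale /= mulrC.
Qed.

(** The primitive arctan ((x - a) / d) vanishes at a and tends to pi / 2. *)
Let poisson_half (a d : R) : 0 < d ->
  (\int[mu]_(x in `[a, +oo[) (poisson d (x - a))%:E = (pi / 2)%:E)%E.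
Proof.
move=> d0.
have cp : continuous (fun x : R => poisson d (x - a)).
  move=> x; apply: (@continuous_comp _ _ _ (fun x => x - a) (poisson d)).
    by apply: cvgB => //; exact: cvg_cst.
  exact: continuous_poisson.
rewrite (@ge0_continuous_FTC2y _ _ (F d a) a (pi / 2)).
- by rewrite /F subrr mul0r atan0 sube0.
- by move=> x _; exact: poisson_ge0.
- exact: continuous_subspaceT.
- rewrite /F. apply: (cvg_comp (fun x => (x - a) / d) atan); last exact: cvgy_atan.
  by apply: gt0_cvgMly; rewrite ?invr_gt0//; exact: cvg_addrr.
- by move=> x _; apply: ex_derive; exact: dF.
- apply: cvg_at_right_filter.
  apply: differentiable_continuous; apply/derivable1_diffP.
  by apply: ex_derive; exact: dF.
- move=> x _; rewrite derive1E. by apply: derive_val; exact: dF.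
Qed.

(** The mass pi does not depend on d: this makes [poisson d] an approximate
identity as d tends to 0, up to the factor pi. *)
Lemma integral_poisson (d a : R) : 0 < d ->
  (\int[mu]_x (poisson d (x - a))%:E = pi%:E)%E.
Proof.
move=> d0.
have cp : continuous (fun x : R => poisson d (x - a)).
  move=> x; apply: (@continuous_comp _ _ _ (fun x => x - a) (poisson d)).
    by apply: cvgB => //; exact: cvg_cst.
  exact: continuous_poisson.
have mp : measurable_fun setT (fun x : R => (poisson d (x - a))%:E).
  by apply/measurable_EFinP; exact: continuous_measurable_fun.
rewrite -(setUv `[a, +oo[%classic) ge0_integral_setU//=; last 4 first.
- exact: measurableC.
- by rewrite setUv.
- by move=> x _; rewrite lee_fin poisson_ge0.
- exact/disj_setPCl.
rewrite poisson_half// setCitvr integral_itv_bndo_bndc; last first.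
  exact: measurable_funTS.
rewrite -{1}(opprK a) ge0_integration_by_substitutionNy//.
- under eq_integral do rewrite /= -poissonN opprD opprK.
  by rewrite poisson_half// -EFinD -splitr.
- exact: continuous_subspaceT.
- by move=> x _; exact: poisson_ge0.
Qed.

Lemma integral_poissonC (d a : R) : 0 < d ->
  (\int[mu]_x (poisson d (a - x))%:E = pi%:E)%E.
Proof.
by move=> d0; under eq_integral do rewrite -poissonN opprB; exact: integral_poisson.
Qed.

Lemma Rintegral_poissonC (d a : R) : 0 < d -> \int[mu]_x poisson d (a - x) = pi.
Proof. by move=> d0; rewrite /Rintegral integral_poissonC. Qed.

Lemma L1_poisson (d a : R) : 0 < d -> L1 (fun x => poisson d (a - x)).
Proof.
move=> d0; apply/integrableP; split.
  apply/measurable_EFinP; apply: continuous_measurable_fun => x.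
  apply: (@continuous_comp _ _ _ (fun x => a - x) (poisson d)).
    by apply: cvgB => //; exact: cvg_cst.
  exact: continuous_poisson.
under eq_integral do rewrite /= ger0_norm ?poisson_ge0//.
by rewrite integral_poissonC// ltry.
Qed.

End PoissonKernel.

Section Laplace.
Context {R : realType}.
Local Notation mu := (@lebesgue_measure R).
Variables (d s : R).
Hypothesis d0 : 0 < d.

Let F (x : R) := expR (- d * x) *
  ((s * sin (x * s) - d * cos (x * s)) / (d ^+ 2 + s ^+ 2) - d^-1).

Let dF (x : R) : is_derive x 1 F (expR (- d * x) * (1 + cos (x * s))).
Proof.
have -> : F = (fun x => expR (- d *: x) *
  ((d ^+ 2 + s ^+ 2)^-1 *: (s *: sin (s *: x) - d *: cos (s *: x)) - cst d^-1 x)).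
  by apply/funext => z; rewrite /F /GRing.scale /= (mulrC z) (mulrC _ (_^-1)).
have d1 : is_derive x 1 (fun x : R => expR (- d *: x)) (- d * expR (- d * x)).
  apply: is_derive_eq; rewrite /GRing.scale /=; ring.
have d2 : is_derive x 1 (fun x : R => sin (s *: x)) (s * cos (x * s)).
  apply: is_derive_eq; rewrite /GRing.scale /= (mulrC x); ring.
have d3 : is_derive x 1 (fun x : R => cos (s *: x)) (- (s * sin (x * s))).
  apply: is_derive_eq; rewrite /GRing.scale /= (mulrC x); ring.
apply: is_derive_eq; rewrite /GRing.scale /= (mulrC s x).
by field; rewrite !gt_eqF ?poisson_den_gt0.
Qed.

Let cF : continuous (fun x : R => expR (- d * x) * (1 + cos (x * s))).
Proof.
move=> x; apply: cvgM.
  apply: (@continuous_comp _ _ _ (fun x => - d * x) expR); last exact: continuous_expR.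
  exact: mulrl_continuous.
apply: cvgD; first exact: cvg_cst.
exact: continuous_cosM.
Qed.

Let F_cvg0 : F x @[x --> +oo%R] --> 0.
Proof.
pose M := (`|s| + d) / (d ^+ 2 + s ^+ 2) + d^-1.
have eM : expR (- d * x) * M @[x --> +oo%R] --> 0.
  rewrite -[X in _ --> X](mul0r M); apply: cvgM; last exact: cvg_cst.
  have -> : (fun x => expR (- d * x)) = (fun x => expR (- (x * d))).
    by apply/funext => x; rewrite mulNr mulrC.
  apply: (cvg_comp (fun x => x * d) (fun x => expR (- x))); last exact: cvgr_expR.
  by apply: gt0_cvgMly => //; exact: cvg_id.
apply: norm_cvg0; apply: squeeze_cvgr (cvg_cst 0) eM.
apply: nearW => x; rewrite normr_ge0/= /F normrM ger0_norm ?expR_ge0//.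
rewrite ler_wpM2l ?expR_ge0// /M (le_trans (ler_normB _ _))// lerD//; last first.
  by rewrite ger0_norm// invr_ge0 ltW.
rewrite normf_div (ger0_norm (ltW (poisson_den_gt0 _ d0))).
apply: ler_wpM2r; first by rewrite invr_ge0 ltW// poisson_den_gt0.
rewrite (le_trans (ler_normB _ _))// lerD//.
  by rewrite normrM ler_piMr// ler_norml sin_geN1 sin_le1.
rewrite normrM (gtr0_norm d0); apply: ler_piMr; first exact: ltW.
by rewrite ler_norml cos_geN1 cos_le1.
Qed.

(** The summand 1 makes the integrand nonnegative, so that the fundamental
theorem of calculus applies on an unbounded interval. *)
Lemma integral_laplace_half :
  (\int[mu]_(x in `[0%R, +oo[) (expR (- d * x) * (1 + cos (x * s)))%:E
  = (d^-1 + poisson d s)%:E)%E.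
Proof.
rewrite (@ge0_continuous_FTC2y _ _ F 0 0).
- rewrite sub0e -EFinN; congr EFin.
  rewrite /F mulr0 expR0 mul1r mul0r sin0 cos0 /poisson.
  by field; rewrite !gt_eqF ?poisson_den_gt0.
- move=> x _; rewrite mulr_ge0 ?expR_ge0//.
- exact: continuous_subspaceT.
- exact: F_cvg0.
- by move=> x _; apply: ex_derive; exact: dF.
- apply: cvg_at_right_filter.
  apply: differentiable_continuous; apply/derivable1_diffP.
  by apply: ex_derive; exact: dF.
- by move=> x _; rewrite derive1E; apply: derive_val; exact: dF.
Qed.

End Laplace.

Section Abel.
Context {R : realType}.
Local Notation mu := (@lebesgue_measure R).
Variable d : R.
Hypothesis d0 : 0 < d.

(** The Abel summation factor that makes Fourier integrals absolutely convergent. *)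
Definition abel (d x : R) := expR (- d * `|x|).

Lemma abel_ge0 x : 0 <= abel d x. Proof. exact: expR_ge0. Qed.

Lemma continuous_abel : continuous (abel d).
Proof.
move=> x; apply: (@continuous_comp _ _ _ (fun x => - d * `|x|) expR); last first.
  exact: continuous_expR.
by apply: cvgM; [exact: cvg_cst|exact: norm_continuous].
Qed.

Let integral_abel_1cos (s : R) :
  (\int[mu]_x (abel d x * (1 + cos (x * s)))%:E = (2 * (d^-1 + poisson d s))%:E)%E.
Proof.
rewrite ge0_symfun_integralT.
- rewrite EFinM -(integral_laplace_half s d0) set_itvcy; congr (_ * _)%E.
  apply: eq_integral => x; rewrite inE /= => x0.
  by rewrite /abel ger0_norm.
- move=> x; rewrite mulr_ge0 ?abel_ge0//.
- move=> x; apply: cvgM; first exact: continuous_abel.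
  apply: cvgD; first exact: cvg_cst.
  exact: continuous_cosM.
- by move=> x; rewrite /abel /= normrN (mulNr x) cosN.
Qed.

Lemma integral_abel : (\int[mu]_x (abel d x)%:E = (2 / d)%:E)%E.
Proof.
have /= := integral_abel_1cos 0.
under eq_integral do rewrite mulr0 cos0 (mulrC (abel _ _)) EFinM.
rewrite ge0_integralZl//; last 2 first.
- by apply/measurable_EFinP; apply: continuous_measurable_fun; exact: continuous_abel.
- by move=> x _; rewrite lee_fin abel_ge0.
have -> : (2 * (d^-1 + poisson d 0))%:E = (2%:E * (2 / d)%:E)%E.
  rewrite -EFinM; congr EFin; rewrite /poisson expr0n/=.
  by field; rewrite gt_eqF.
move/(congr1 (fun z => 2^-1%:E * z)%E).
by rewrite !muleA -EFinM mulVf// !mul1e.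
Qed.

Lemma L1_abel : L1 (abel d).
Proof.
apply/integrableP; split.
  by apply/measurable_EFinP; apply: continuous_measurable_fun; exact: continuous_abel.
under eq_integral do rewrite /= ger0_norm ?abel_ge0//.
by rewrite integral_abel ltry.
Qed.

(** Obtained by subtracting the case s = 0 from the integral of
[abel d x * (1 + cos (x * s))], whose integrand is nonnegative. *)
Lemma Rintegral_abel_cos (s : R) : \int[mu]_x (abel d x * cos (x * s)) = 2 * poisson d s.
Proof.
have La : L1 (fun x => abel d x * cos (x * s)).
  apply: (@L1M _ _ _ 1 L1_abel); last by move=> x; rewrite ler_norml cos_geN1 cos_le1.
  by apply: measurable_cos_comp; exact: measurable_funM.
have := integral_abel_1cos s; move/(congr1 fine) => /=.
rewrite -/(Rintegral _ _ _).
under eq_Rintegral do rewrite mulrDr mulr1.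
rewrite RintegralD//; last exact: L1_abel.
rewrite {1}/Rintegral integral_abel /= => h.
apply: (addrI (2 / d)); rewrite h; ring.
Qed.

End Abel.

(** * Convolution with the Poisson kernel *)

Section Fubini.
Context {R : realType}.
Local Notation mu := (@lebesgue_measure R).

(** Fubini for real-valued integrals.  The domination by a product makes the
inner integrals finite at every point, not only almost everywhere, so that they
can be read as real numbers. *)
Lemma Rfubini (k : R * R -> R) (a b : R -> R) :
  measurable_fun setT k -> L1 a -> L1 b ->
  (forall x y, `|k (x, y)| <= a x * b y) ->
  \int[mu]_x (\int[mu]_y k (x, y)) = \int[mu]_y (\int[mu]_x k (x, y)).
Proof.
move=> mk La Lb kab.
have a0b0 x y : 0 <= a x * b y := le_trans (normr_ge0 _) (kab x y).
have mx x : measurable_fun setT (fun y => k (x, y)).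
  by apply: (measurableT_comp mk); exact: measurable_pair1.
have my y : measurable_fun setT (fun x => k (x, y)).
  by apply: (measurableT_comp mk); exact: measurable_pair2.
have Lx x : L1 (fun y => k (x, y)).
  apply: (le_L1 (mx x)) (L1Z (a x) Lb) => y.
  by rewrite (le_trans (kab x y))// ler_norm.
have Ly y : L1 (fun x => k (x, y)).
  apply: (le_L1 (my y)) (L1Z (b y) La) => x.
  by rewrite (le_trans (kab x y))// mulrC ler_norm.
have bE : ((\int[mu]_y `|b y|)%:E = \int[mu]_y (`|b y|)%:E)%E.
  rewrite /Rintegral fineK//; apply: integrable_fin_num => //; exact: L1_norm.
have ik : (mu \x mu)%E.-integrable setT (EFin \o k).
  apply/integrable12ltyP; first exact/measurable_EFinP.
  apply: (@le_lt_trans _ _ (\int[mu]_x (`|a x| * \int[mu]_y `|b y|)%:E)%E).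
    apply: ge0_le_integral => //.
    - by move=> x _; apply: integral_ge0.
    - have mk' : measurable_fun setT (fun z : R * R => `|(k z)%:E|%E).
        by apply: measurableT_comp => //; exact/measurable_EFinP.
      have := @measurable_fun_fubini_tonelli_F _ _ (measurableTypeR R) _ R mu (fun z : R * R => `|(k z)%:E|%E).
      by apply => //= z; exact: abse_ge0.
    - apply/measurable_EFinP; apply: measurable_funM => //.
      by apply: measurableT_comp => //; exact: L1_measurable.
    - move=> x _; rewrite EFinM bE -ge0_integralZl//; last first.
        by do 2 apply: measurableT_comp => //; exact: L1_measurable.
      apply: ge0_le_integral => //.
      + by apply: measurableT_comp => //; apply/measurable_EFinP; exact: mx.
      + apply: measurable_funeM; do 2 apply: measurableT_comp => //.
        exact: L1_measurable.
      + by move=> y _; rewrite /= -EFinM lee_fin -normrM (le_trans (kab x y))// ler_norm.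
  have la : L1 (fun x => `|a x| * \int[mu]_y `|b y|).
    by apply: (eq_L1 _ (L1Z _ (L1_norm La))) => x; rewrite mulrC.
  exact: integrable_lty la.
have -> : \int[mu]_x (\int[mu]_y k (x, y)) = fine (\int[mu]_x \int[mu]_y (k (x, y))%:E)%E.
  congr fine; apply: eq_integral => x _; rewrite /Rintegral fineK//.
  by apply: integrable_fin_num => //; exact: Lx.
have -> : \int[mu]_y (\int[mu]_x k (x, y)) = fine (\int[mu]_y \int[mu]_x (k (x, y))%:E)%E.
  congr fine; apply: eq_integral => y _; rewrite /Rintegral fineK//.
  by apply: integrable_fin_num => //; exact: Ly.
congr fine; exact: (Fubini ik).
Qed.

End Fubini.

Section Convolution.
Context {R : realType}.
Local Notation mu := (@lebesgue_measure R).
Implicit Types f h : R -> R.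

Definition conv_poisson (d : R) f (a : R) := \int[mu]_y (f y * poisson d (a - y)).

Lemma L1_mul_poisson (d a : R) f : 0 < d -> L1 f ->
  L1 (fun y => f y * poisson d (a - y)).
Proof.
move=> d0 Lf; apply: (@L1M _ _ _ d^-1 Lf).
  exact: L1_measurable (L1_poisson a d0).
by move=> x; rewrite ger0_norm ?poisson_ge0// poisson_le.
Qed.

Lemma conv_poisson_le (d a : R) f : 0 < d -> L1 f ->
  `|conv_poisson d f a| <= d^-1 * \int[mu]_y `|f y|.
Proof.
move=> d0 Lf; have Li := L1_mul_poisson a d0 Lf.
apply: (le_trans (le_normr_Rintegral measurableT Li)).
rewrite -RintegralZl//; last exact: L1_norm.
apply: le_Rintegral => //; [exact: L1_norm|exact: (L1Z d^-1 (L1_norm Lf))|].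
move=> x _; rewrite normrM mulrC ler_wpM2r//.
by rewrite ger0_norm ?poisson_ge0// poisson_le.
Qed.

Lemma continuous_conv_poisson (d : R) f : 0 < d -> L1 f -> continuous (conv_poisson d f).
Proof.
move=> d0 Lf a.
have Ia : a \in (`]a - 1, a + 1[%classic : set R).
  by rewrite inE /= in_itv/= ltrBlDr ltrDl ltr01.
apply: (@continuity_under_integral R _ _ mu (fun a y => f y * poisson d (a - y)) setT
  measurableT (a - 1) (a + 1) _ _ (fun y => d^-1 * `|f y|) _ _ a Ia).
- by move=> x _; exact: L1_mul_poisson.
- apply: aeW => y _ x _; apply: cvgM; first exact: cvg_cst.
  apply: (@continuous_comp _ _ _ (fun x => x - y) (poisson d)).
    by apply: cvgB => //; exact: cvg_cst.
  exact: continuous_poisson.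
- exact: (L1Z d^-1 (L1_norm Lf)).
- move=> x _; apply: aeW => y _; rewrite normrM mulrC ler_wpM2r//.
  by rewrite ger0_norm ?poisson_ge0// poisson_le.
Qed.

Lemma L1_mul_conv_poisson (d : R) f h : 0 < d -> L1 f -> L1 h ->
  L1 (fun x => h x * conv_poisson d f x).
Proof.
move=> d0 Lf Lh; apply: (L1M Lh).
  by apply: continuous_measurable_fun; exact: continuous_conv_poisson.
by move=> x; exact: conv_poisson_le.
Qed.

(** Tonelli: integrating first in the variable of the kernel gives the mass pi. *)
Lemma integral_conv_poisson (d : R) h : 0 < d -> L1 h -> (forall x, 0 <= h x) ->
  L1 (conv_poisson d h) /\ \int[mu]_x conv_poisson d h x = pi * \int[mu]_x h x.
Proof.
move=> d0 Lh h0.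
have cv0 x : 0 <= conv_poisson d h x.
  by apply: Rintegral_ge0 => y _; rewrite mulr_ge0// poisson_ge0.
have mh := L1_measurable Lh.
have E : (\int[mu]_x (conv_poisson d h x)%:E = (pi * \int[mu]_x h x)%:E)%E.
  transitivity (\int[mu]_x \int[mu]_y (h y * poisson d (x - y))%:E)%E.
    apply: eq_integral => x _; rewrite /conv_poisson /Rintegral fineK//.
    by apply: integrable_fin_num => //; exact: L1_mul_poisson.
  have := @fubini_tonelli _ _ _ _ R mu mu
    (fun z : R * R => (h z.2 * poisson d (z.1 - z.2))%:E) => /= ->; last 2 first.
  - apply/measurable_EFinP; apply: measurable_funM.
      exact: (measurableT_comp mh).
    apply: (@measurableT_comp _ _ _ _ _ _ (poisson d)).
      by apply: continuous_measurable_fun; exact: continuous_poisson.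
    exact: measurable_funB.
  - by move=> z; rewrite lee_fin mulr_ge0// poisson_ge0.
  transitivity (\int[mu]_y (pi%:E * (h y)%:E))%E.
    apply: eq_integral => y _; under eq_integral do rewrite EFinM.
    rewrite ge0_integralZl//; first by rewrite integral_poisson// muleC.
    - apply/measurable_EFinP; apply: continuous_measurable_fun => x.
      apply: (@continuous_comp _ _ _ (fun x => x - y) (poisson d)).
        by apply: cvgB => //; exact: cvg_cst.
      exact: continuous_poisson.
    - by move=> x _; rewrite lee_fin poisson_ge0.
    - by rewrite lee_fin.
  rewrite ge0_integralZl//; last 3 first.
  - exact/measurable_EFinP.
  - by move=> x _; rewrite lee_fin.
  - by rewrite lee_fin pi_ge0.
  rewrite EFinM /Rintegral fineK//.
  exact: integrable_fin_num.
split; last by rewrite /Rintegral E.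
apply/integrableP; split.
  apply/measurable_EFinP; apply: continuous_measurable_fun.
  exact: continuous_conv_poisson.
under eq_integral do rewrite /= ger0_norm//.
by rewrite E ltry.
Qed.

(** The inequality 2 u v <= u^2 + v^2 under the double integral, each square
being then integrated against a kernel of mass pi. *)
Lemma poisson_form_le (d : R) f : 0 < d -> L1 f -> L1 (fun x => f x ^+ 2) ->
  \int[mu]_x (f x * conv_poisson d f x) <= pi * \int[mu]_x (f x ^+ 2).
Proof.
move=> d0 Lf Lf2.
have [Lc Ec] := integral_conv_poisson d0 Lf2 (fun x => sqr_ge0 (f x)).
have -> : pi * \int[mu]_x (f x ^+ 2) =
    \int[mu]_x (pi / 2 * f x ^+ 2 + 2^-1 * conv_poisson d (fun x => f x ^+ 2) x).
  rewrite RintegralD//; [|exact: L1Z..].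
  by rewrite !RintegralZl// Ec; field.
apply: le_Rintegral => //; first exact: L1_mul_conv_poisson.
  by apply: L1D; exact: L1Z.
move=> x _; rewrite /conv_poisson -RintegralZl//; last exact: L1_mul_poisson.
have -> : pi / 2 * f x ^+ 2 = \int[mu]_y (2^-1 * f x ^+ 2 * poisson d (x - y)).
  rewrite RintegralZl//; last exact: L1_poisson.
  by rewrite /Rintegral integral_poissonC//= ; ring.
rewrite -[X in _ + X]RintegralZl//; last exact: L1_mul_poisson.
rewrite -RintegralD//; last 2 first.
- by apply: L1Z; exact: L1_poisson.
- by apply: L1Z; exact: L1_mul_poisson.
apply: le_Rintegral => //.
- by apply: L1Z; exact: L1_mul_poisson.
- apply: L1D; first by apply: L1Z; exact: L1_poisson.
  by apply: L1Z; exact: L1_mul_poisson.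
move=> y _; rewrite -subr_ge0.
have -> : 2^-1 * f x ^+ 2 * poisson d (x - y) +
  2^-1 * (f y ^+ 2 * poisson d (x - y)) - f x * (f y * poisson d (x - y))
  = 2^-1 * (f x - f y) ^+ 2 * poisson d (x - y) by field.
by rewrite mulr_ge0 ?poisson_ge0// mulr_ge0 ?sqr_ge0.
Qed.

End Convolution.

(** * Cosine and sine transforms of integrable functions *)

Section TrigTransform.
Context {R : realType}.
Local Notation mu := (@lebesgue_measure R).
Implicit Types f h : R -> R.

Definition cosT f (x : R) := \int[mu]_xi (f xi * cos (x * xi)).
Definition sinT f (x : R) := \int[mu]_xi (f xi * sin (x * xi)).
(** The squared modulus of the Fourier integral of a real function. *)
Definition energy f (x : R) := cosT f x ^+ 2 + sinT f x ^+ 2.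

Lemma norm_cos_le1 (x : R) : `|cos x| <= 1.
Proof. by rewrite ler_norml cos_geN1 cos_le1. Qed.

Lemma norm_sin_le1 (x : R) : `|sin x| <= 1.
Proof. by rewrite ler_norml sin_geN1 sin_le1. Qed.

Lemma L1_mul_cos f h : L1 f -> measurable_fun setT h -> L1 (fun xi => f xi * cos (h xi)).
Proof.
by move=> Lf mh; apply: (L1M Lf); [exact: measurable_cos_comp|
  move=> x; exact: norm_cos_le1].
Qed.

Lemma L1_mul_sin f h : L1 f -> measurable_fun setT h -> L1 (fun xi => f xi * sin (h xi)).
Proof.
by move=> Lf mh; apply: (L1M Lf); [exact: measurable_sin_comp|
  move=> x; exact: norm_sin_le1].
Qed.

Let continuous_trig f (c : R -> R) : L1 f -> continuous c -> (forall x, `|c x| <= 1) ->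
  continuous (fun x : R => \int[mu]_xi (f xi * c (x * xi))).
Proof.
move=> Lf cc c1 a.
have Ia : a \in (`]a - 1, a + 1[%classic : set R).
  by rewrite inE /= in_itv/= ltrBlDr ltrDl ltr01.
apply: (@continuity_under_integral R _ _ mu (fun a y => f y * c (a * y)) setT
  measurableT (a - 1) (a + 1) _ _ (fun y => `|f y|) _ _ a Ia).
- move=> x _; apply: (L1M Lf _ (fun y => c1 _)).
  apply: (@measurableT_comp _ _ _ _ _ _ c); first exact: continuous_measurable_fun.
  exact: measurable_funM.
- apply: aeW => y _ x _; apply: cvgM; first exact: cvg_cst.
  apply: (@continuous_comp R R R (fun x => x * y) c); last exact: cc.
  exact: mulrr_continuous.
- exact: L1_norm.
- by move=> x _; apply: aeW => y _; rewrite normrM ler_piMr.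
Qed.

Lemma continuous_cosT f : L1 f -> continuous (cosT f).
Proof.
by move=> Lf; apply: continuous_trig => //; [exact: continuous_cos|exact: norm_cos_le1].
Qed.

Lemma continuous_sinT f : L1 f -> continuous (sinT f).
Proof.
by move=> Lf; apply: continuous_trig => //; [exact: continuous_sin|exact: norm_sin_le1].
Qed.

Lemma continuous_energy f : L1 f -> continuous (energy f).
Proof.
move=> Lf x; apply: cvgD.
  by apply: (@continuous_comp _ _ _ (cosT f) (fun z => z ^+ 2));
    [exact: continuous_cosT|exact: exprn_continuous].
by apply: (@continuous_comp _ _ _ (sinT f) (fun z => z ^+ 2));
  [exact: continuous_sinT|exact: exprn_continuous].
Qed.

Lemma energy_ge0 f x : 0 <= energy f x.
Proof. by rewrite addr_ge0 ?sqr_ge0. Qed.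

Lemma norm_cos_kernel_le f (x xi : R) : L1 f ->
  `|\int[mu]_eta (f eta * cos (x * (xi - eta)))| <= \int[mu]_eta `|f eta|.
Proof.
move=> Lf; have Li : L1 (fun eta => f eta * cos (x * (xi - eta))).
  by apply: L1_mul_cos => //; apply: measurable_funM => //; exact: measurable_funB.
apply: (le_trans (le_normr_Rintegral measurableT Li)).
apply: le_Rintegral => //; [exact: L1_norm|exact: L1_norm|].
by move=> eta _; rewrite normrM ler_piMr// norm_cos_le1.
Qed.

(** The addition formula for the cosine; read from right to left it also shows
that the right-hand side is measurable in (x, xi) jointly. *)
Lemma cosT_sinT_shift f (x xi : R) : L1 f ->
  cos (x * xi) * cosT f x + sin (x * xi) * sinT f x
  = \int[mu]_eta (f eta * cos (x * (xi - eta))).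
Proof.
move=> Lf; have mx : measurable_fun setT (fun y : R => x * y) by exact: measurable_funM.
rewrite -!RintegralZl//; [|exact: L1_mul_sin|exact: L1_mul_cos].
rewrite -RintegralD//; [|by apply: L1Z; exact: L1_mul_cos|by apply: L1Z; exact: L1_mul_sin].
by apply: eq_Rintegral => eta _; rewrite mulrBr cosB; ring.
Qed.

Lemma energyE f (x : R) : L1 f -> energy f x =
  \int[mu]_xi (f xi * \int[mu]_eta (f eta * cos (x * (xi - eta)))).
Proof.
move=> Lf; have mx : measurable_fun setT (fun y : R => x * y) by exact: measurable_funM.
under eq_Rintegral do rewrite -cosT_sinT_shift//.
rewrite /energy [in LHS]expr2 [X in _ + X]expr2 {1}/cosT {2}/sinT.
rewrite -!RintegralZr//; [|exact: L1_mul_sin|exact: L1_mul_cos].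
rewrite -RintegralD//; last 2 first.
- apply: (@eq_L1 _ (fun xi => cosT f x * (f xi * cos (x * xi)))).
    by move=> xi; rewrite mulrC.
  by apply: L1Z; exact: L1_mul_cos.
- apply: (@eq_L1 _ (fun xi => sinT f x * (f xi * sin (x * xi)))).
    by move=> xi; rewrite mulrC.
  by apply: L1Z; exact: L1_mul_sin.
by apply: eq_Rintegral => xi _; rewrite -/(sinT f x); ring.
Qed.

Lemma energy_le f (x : R) : L1 f -> energy f x <= (\int[mu]_xi `|f xi|) ^+ 2 *+ 2.
Proof.
move=> Lf; have mx : measurable_fun setT (fun y : R => x * y) by exact: measurable_funM.
have h (c : R -> R) : L1 (fun xi => f xi * c xi) -> (forall xi, `|c xi| <= 1) ->
    (\int[mu]_xi (f xi * c xi)) ^+ 2 <= (\int[mu]_xi `|f xi|) ^+ 2.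
  move=> Lc c1; rewrite -real_normK ?num_real// ler_pXn2r ?nnegrE//; last first.
    exact: Rintegral_ge0.
  apply: (le_trans (le_normr_Rintegral measurableT Lc)).
  apply: le_Rintegral => //; [exact: L1_norm|exact: L1_norm|].
  by move=> eta _; rewrite normrM ler_piMr.
rewrite mulr2n lerD// h//.
- exact: L1_mul_cos.
- by move=> xi; exact: norm_cos_le1.
- exact: L1_mul_sin.
- by move=> xi; exact: norm_sin_le1.
Qed.

Lemma L1_abel_energy (d : R) f : 0 < d -> L1 f -> L1 (fun x => abel d x * energy f x).
Proof.
move=> d0 Lf; apply: (L1M (L1_abel d0)).
  by apply: continuous_measurable_fun; exact: continuous_energy.
by move=> x; rewrite ger0_norm ?energy_ge0//; exact: energy_le.
Qed.

(** Two applications of Fubini: expand the energy as a double integral of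
f(xi) f(eta) cos (x (xi - eta)), then integrate in x first. *)
Lemma abel_energy (d : R) f : 0 < d -> L1 f ->
  \int[mu]_x (abel d x * energy f x) = 2 * \int[mu]_xi (f xi * conv_poisson d f xi).
Proof.
move=> d0 Lf; have mf := L1_measurable Lf; have La := L1_abel d0.
pose c (x xi : R) := \int[mu]_eta (f eta * cos (x * (xi - eta))).
have Lc (x : R) : L1 (fun xi => f xi * c x xi).
  have mx : measurable_fun setT (fun y : R => x * y) by exact: measurable_funM.
  apply: (@L1M _ _ _ (\int[mu]_eta `|f eta|) Lf); last by move=> xi; exact: norm_cos_kernel_le.
  rewrite /c (_ : (fun xi => _) = (fun xi => cos (x * xi) * cosT f x + sin (x * xi) * sinT f x)).
    by apply: measurable_funD; apply: measurable_funM => //;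
      [exact: measurable_cos_comp|exact: measurable_sin_comp].
  by apply/funext => xi; rewrite cosT_sinT_shift.
have mab : measurable_fun setT (abel d).
  by apply: continuous_measurable_fun; exact: continuous_abel.
have mmul : measurable_fun setT (fun z : R * R => z.1 * z.2) by exact: measurable_funM.
transitivity (\int[mu]_x \int[mu]_xi (abel d x * (f xi * c x xi))).
  apply: eq_Rintegral => x _; rewrite energyE// -RintegralZl//; exact: Lc.
rewrite (Rfubini (k := fun z => abel d z.1 * (f z.2 * c z.1 z.2))
  (a := abel d) (b := fun xi => `|f xi| * \int[mu]_eta `|f eta|)) //=; last 3 first.
- apply: measurable_funM; first exact: (measurableT_comp mab).
  apply: measurable_funM; first exact: (measurableT_comp mf).
  rewrite /c (_ : (fun xi => _) = (fun z : R * R =>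
    cos (z.1 * z.2) * cosT f z.1 + sin (z.1 * z.2) * sinT f z.1)); last first.
    by apply/funext => z; rewrite cosT_sinT_shift.
  apply: measurable_funD; apply: measurable_funM.
  + exact: measurable_cos_comp.
  + apply: (@measurableT_comp _ _ _ _ _ _ (cosT f)) => //.
    by apply: continuous_measurable_fun; exact: continuous_cosT.
  + exact: measurable_sin_comp.
  + apply: (@measurableT_comp _ _ _ _ _ _ (sinT f)) => //.
    by apply: continuous_measurable_fun; exact: continuous_sinT.
- apply: (eq_L1 _ (L1Z (\int[mu]_eta `|f eta|) (L1_norm Lf))) => xi.
  by rewrite mulrC.
- move=> x xi; rewrite !normrM (ger0_norm (abel_ge0 _ _)) ler_wpM2l ?abel_ge0//.
  by rewrite ler_wpM2l//; exact: norm_cos_kernel_le.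
rewrite -RintegralZl//; last exact: L1_mul_conv_poisson.
apply: eq_Rintegral => xi _.
transitivity (f xi * \int[mu]_x \int[mu]_eta (abel d x * (f eta * cos (x * (xi - eta))))).
  rewrite -RintegralZl//.
    apply: eq_Rintegral => x _; rewrite /c RintegralZl//; first ring.
    by apply: L1_mul_cos => //; apply: measurable_funM => //; exact: measurable_funB.
  rewrite (_ : (fun x => _) = (fun x => abel d x * c x xi)); last first.
    apply/funext => x; rewrite /c RintegralZl//.
    by apply: L1_mul_cos => //; apply: measurable_funM => //; exact: measurable_funB.
  apply: (L1M La); last by move=> x; exact: norm_cos_kernel_le.
  rewrite /c (_ : (fun x => _) = (fun x => cos (x * xi) * cosT f x + sin (x * xi) * sinT f x)).
    apply: continuous_measurable_fun.
    move=> x; apply: cvgD; apply: cvgM.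
    - exact: continuous_cosM.
    - exact: continuous_cosT.
    - exact: continuous_sinM.
    - exact: continuous_sinT.
  by apply/funext => x; rewrite cosT_sinT_shift.
rewrite (Rfubini (k := fun z => abel d z.1 * (f z.2 * cos (z.1 * (xi - z.2))))
  (a := abel d) (b := fun eta => `|f eta|)) //=; last 3 first.
- apply: measurable_funM; first exact: (measurableT_comp mab).
  apply: measurable_funM; first exact: (measurableT_comp mf).
  by apply: measurable_cos_comp; apply: measurable_funM => //; exact: measurable_funB.
- exact: L1_norm.
- move=> x eta; rewrite !normrM (ger0_norm (abel_ge0 _ _)) ler_wpM2l ?abel_ge0//.
  by rewrite ler_piMr// norm_cos_le1.
rewrite /conv_poisson mulrCA; congr (_ * _); rewrite -RintegralZl//; last exact: L1_mul_poisson.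
apply: eq_Rintegral => eta _.
transitivity (f eta * \int[mu]_x (abel d x * cos (x * (xi - eta)))).
  rewrite -RintegralZl//; first by apply: eq_Rintegral => x _; ring.
  by apply: (L1_mul_cos La); exact: measurable_funM.
by rewrite Rintegral_abel_cos//; ring.
Qed.

End TrigTransform.

(** * Plancherel's theorem for real functions *)

Section AbelLimit.
Context {R : realType}.
Local Notation mu := (@lebesgue_measure R).
Implicit Types f h : R -> R.

(** Plancherel's identity as a property of f, to be extended step by step
from regular functions to all square-integrable ones. *)
Definition real_isometric f :=
  (\int[mu]_x (energy f x)%:E = (2 * pi * \int[mu]_x (f x ^+ 2))%:E)%E.

(** Monotone convergence: the factors exp (- |x| / (n + 1)) increase to 1. *)
Lemma abel_energy_cvg f : L1 f ->
  ((2 * \int[mu]_x (f x * conv_poisson (harmonic n) f x))%:E @[n --> \oo] -->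
  \int[mu]_x (energy f x)%:E)%E.
Proof.
move=> Lf.
have -> : (fun n => (2 * \int[mu]_x (f x * conv_poisson (harmonic n) f x))%:E) =
    (fun n => \int[mu]_x (abel (harmonic n) x * energy f x)%:E)%E.
  apply/funext => n; have d0 := @harmonic_gt0 R n.
  rewrite -abel_energy// /Rintegral fineK//; apply: integrable_fin_num => //.
  exact: L1_abel_energy.
have me n : measurable_fun setT (fun x => (abel (harmonic n) x * energy f x)%:E).
  apply/measurable_EFinP; apply: L1_measurable; apply: L1_abel_energy => //.
  exact: harmonic_gt0.
have nde x : {homo (fun n => (abel (harmonic n) x * energy f x)%:E) : n m / (n <= m)%N >-> (n <= m)%E}.
  move=> n m nm; rewrite lee_fin ler_wpM2r ?energy_ge0// ler_expR.
  rewrite ler_wpM2r// lerN2 /harmonic /= lef_pV2 ?posrE//.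
  by rewrite ler_nat ltnS.
have cve x : ((abel (harmonic n) x * energy f x)%:E @[n --> \oo] --> (energy f x)%:E)%E.
  apply: cvg_EFin; first exact: nearW.
  rewrite -[X in _ --> X]mul1r; apply: cvgM; last exact: cvg_cst.
  rewrite -expR0 /abel.
  suff h : - harmonic n * `|x| @[n --> \oo] --> (0 : R).
    by apply: (cvg_comp _ expR h); exact: continuous_expR.
  rewrite -[X in _ --> X](mul0r `|x|); apply: cvgM; last exact: cvg_cst.
  rewrite -oppr0; apply: cvgN; exact: cvg_harmonic.
have := @cvg_monotone_convergence _ _ _ mu _ measurableT
  (fun n x => (abel (harmonic n) x * energy f x)%:E) me _ (fun x _ => nde x).
have -> : (\int[mu]_x limn (fun n => (abel (harmonic n) x * energy f x)%:E) =
    \int[mu]_x (energy f x)%:E)%E.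
  by apply: eq_integral => x _; apply/cvg_lim => //; exact: cve.
by apply=> n x _; rewrite lee_fin mulr_ge0 ?abel_ge0 ?energy_ge0.
Qed.

Lemma energy_integral_le f : L1 f -> L1 (fun x => f x ^+ 2) ->
  (\int[mu]_x (energy f x)%:E <= (2 * pi * \int[mu]_x (f x ^+ 2))%:E)%E.
Proof.
move=> Lf Lf2; have cv := abel_energy_cvg Lf.
rewrite -(cvg_lim _ cv)//; apply: lime_le; first by apply/cvg_ex; eexists; exact: cv.
apply: nearW => n; rewrite lee_fin -mulrA ler_wpM2l//.
by apply: poisson_form_le => //; exact: harmonic_gt0.
Qed.

Lemma L1_energy f : L1 f -> L1 (fun x => f x ^+ 2) -> L1 (energy f).
Proof.
move=> Lf Lf2; apply/integrableP; split.
  apply/measurable_EFinP; apply: continuous_measurable_fun; exact: continuous_energy.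
under eq_integral do rewrite /= ger0_norm ?energy_ge0//.
by apply: (le_lt_trans (energy_integral_le Lf Lf2)); rewrite ltry.
Qed.

Lemma conv_poisson_bound f (M d x : R) : L1 f -> (forall y, `|f y| <= M) -> 0 < d ->
  `|conv_poisson d f x| <= M * pi.
Proof.
move=> Lf fM d0; have Li := L1_mul_poisson x d0 Lf.
apply: (le_trans (le_normr_Rintegral measurableT Li)).
have -> : M * pi = \int[mu]_y (M * poisson d (x - y)).
  rewrite RintegralZl//; last exact: L1_poisson.
  by rewrite Rintegral_poissonC.
apply: le_Rintegral => //; [exact: L1_norm|apply: L1Z; exact: L1_poisson|].
move=> y _; rewrite normrM (ger0_norm (poisson_ge0 _ d0)).
by rewrite ler_wpM2r// poisson_ge0.
Qed.

(** Away from the diagonal the kernel is bounded by a multiple of d times one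
fixed integrable kernel. *)
Lemma poisson_far (d r s : R) : 0 < d -> 0 < r -> r <= `|s| ->
  poisson d s <= d * (1 + r ^- 2) * poisson 1 s.
Proof.
move=> d0 r0 rs; rewrite /poisson expr1n div1r -mulrA ler_wpM2l ?(ltW d0)//.
have s2 : r ^+ 2 <= s ^+ 2.
  by rewrite -(real_normK (num_real s)) ler_pXn2r ?nnegrE ?(ltW r0).
have sp : 0 < s ^+ 2 by rewrite (lt_le_trans _ s2)// exprn_gt0.
rewrite ler_pdivlMr ?ltr_pwDl ?sqr_ge0//.
rewrite mulrC ler_pdivrMr ?poisson_den_gt0//.
have h : 1 <= r ^- 2 * s ^+ 2 by rewrite mulrC ler_pdivlMr ?exprn_gt0// mul1r.
rewrite mulrDl mul1r mulrDr.
have : 0 <= r ^- 2 * d ^+ 2 by rewrite mulr_ge0 ?sqr_ge0// invr_ge0 sqr_ge0.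
have := sqr_ge0 d.
lra.
Qed.

(** Near x the oscillation of f is small and the kernel has mass pi; far from
x the kernel is small by [poisson_far].  Both bounds are added into one that is
valid everywhere, which avoids splitting the domain of integration. *)
Lemma conv_poisson_cvg f (M x : R) : L1 f -> (forall y, `|f y| <= M) ->
  {for x, continuous f} ->
  conv_poisson (harmonic n) f x @[n --> \oo] --> pi * f x.
Proof.
move=> Lf fM cf; apply/cvgrPdist_le => e e0.
have p0 : 0 < pi :> R := pi_gt0 R.
(* half of the error e is left for the mass pi of the kernel near x *)
pose e' := e / (2 * pi).
have e'0 : 0 < e' by rewrite divr_gt0// mulr_gt0.
move/cvgrPdist_le : (cf) => /(_ _ e'0) [r /= r0 fr].
have M0 : 0 <= M := le_trans (normr_ge0 _) (fM x).
pose K := 2 * M * (1 + r ^- 2).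
have : harmonic n * (K * pi) @[n --> \oo] --> 0 * (K * pi).
  by apply: cvgM; [exact: cvg_harmonic|exact: cvg_cst].
rewrite mul0r => /cvgrPdist_le /(_ (e / 2)) [|N _ hN]; first by rewrite divr_gt0.
exists N => // n /hN {hN} /=; rewrite sub0r normrN => /(le_trans (ler_norm _)) hn.
have := @harmonic_gt0 R n; rewrite /harmonic/=; move: (n.+1%:R^-1) hn => d hd d0.
have Li := L1_mul_poisson x d0 Lf.
have Lp := L1_poisson x d0; have Lp1 := L1_poisson x (@ltr01 R).
have -> : pi * f x = \int[mu]_y (f x * poisson d (x - y)).
  rewrite RintegralZl//.
  by rewrite Rintegral_poissonC// mulrC.
rewrite -RintegralB//; last exact: L1Z.
have Lb : L1 (fun y => f x * poisson d (x - y) - f y * poisson d (x - y)).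
  by apply: L1B => //; exact: L1Z.
apply: (le_trans (le_normr_Rintegral measurableT Lb)).
have eE : e' * pi + e / 2 = e.
  by rewrite /e' invfM mulrA mulfVK ?gt_eqF// -splitr.
rewrite -[leRHS]eE.
apply: (@le_trans _ _ (\int[mu]_y (e' * poisson d (x - y) + d * K * poisson 1 (x - y)))).
  apply: le_Rintegral => //; [exact: L1_norm|by apply: L1D; exact: L1Z|].
  move=> y _; rewrite -mulrBl normrM (ger0_norm (poisson_ge0 _ d0)).
  have [yr|yr] := ltP `|x - y| r.
    rewrite -[leLHS]addr0 lerD//.
      by rewrite ler_wpM2r ?poisson_ge0//; exact: fr.
    by rewrite mulr_ge0 ?poisson_ge0// !mulr_ge0 ?(ltW d0)// addr_ge0 ?invr_ge0 ?sqr_ge0.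
  rewrite -[leLHS]add0r lerD//; first by rewrite mulr_ge0 ?poisson_ge0 ?ltW.
  apply: (@le_trans _ _ (2 * M * poisson d (x - y))).
    rewrite ler_wpM2r ?poisson_ge0// (le_trans (ler_normB _ _))//.
    by rewrite mulr_natl mulr2n lerD.
  have := poisson_far d0 r0 yr.
  move/(ler_wpM2l (mulr_ge0 (ler0n R 2) M0)) /le_trans; apply.
  by rewrite /K le_eqVlt; apply/orP; left; apply/eqP; ring.
rewrite RintegralD//; [|exact: L1Z..].
rewrite RintegralZl// [X in _ + X]RintegralZl// !Rintegral_poissonC// lerD2l.
by rewrite -mulrA.
Qed.

(** The Poisson means converge at each point of the open interval, and the points
outside do not matter because f also appears as a factor; dominated convergence
concludes. *)
Lemma real_isometric_continuous_itv f (M k : R) : measurable_fun setT f -> (forall y, `|f y| <= M) ->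
  (forall x, ~~ (- k < x < k) -> f x = 0) ->
  (forall x, - k < x < k -> {for x, continuous f}) -> real_isometric f.
Proof.
move=> mf fM f0 cf.
have M0 : 0 <= M := le_trans (normr_ge0 _) (fM 0).
have Li : L1 (fun x => \1_(`]- k, k[%classic : set R) x) by exact: integrable_indic_itv.
have fI x : `|f x| <= `|M * \1_(`]- k, k[%classic : set R) x|.
  rewrite indicE mem_setE in_itv/=; have [kx|kx] := boolP (- k < x < k); last by rewrite f0// normr0.
  by rewrite mulr1 (ger0_norm M0).
have Lf : L1 f by apply: (le_L1 mf fI); exact: L1Z.
have Lf2 : L1 (fun x => f x ^+ 2).
  by apply: (eq_L1 _ (L1M Lf mf fM)) => x; rewrite expr2.
have cv : ((\int[mu]_x (f x * conv_poisson (harmonic n) f x))%:E @[n --> \oo] -->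
    (pi * \int[mu]_x (f x ^+ 2))%:E)%E.
  have -> : (pi * \int[mu]_x (f x ^+ 2))%:E = (\int[mu]_x (f x * (pi * f x))%:E)%E.
    rewrite -RintegralZl// /Rintegral fineK.
      by apply: eq_integral => x _; congr EFin; ring.
    by apply: integrable_fin_num => //; exact: L1Z.
  have -> : (fun n => (\int[mu]_x (f x * conv_poisson (harmonic n) f x))%:E) =
      (fun n => \int[mu]_x (f x * conv_poisson (harmonic n) f x)%:E)%E.
    apply/funext => n; rewrite /Rintegral fineK//; apply: integrable_fin_num => //.
    by apply: L1_mul_conv_poisson => //; exact: harmonic_gt0.
  apply: (@dominated_cvg _ _ _ mu _ measurableT
    (fun n x => (f x * conv_poisson (harmonic n) f x)%:E) _ (fun x => (M * pi * `|f x|)%:E)).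
  - move=> n; apply/measurable_EFinP; apply: L1_measurable.
    by apply: L1_mul_conv_poisson => //; exact: harmonic_gt0.
  - move=> x _; apply: cvg_EFin; first exact: nearW.
    have [kx|kx] := boolP (- k < x < k); last first.
      rewrite f0// mul0r; under eq_fun do rewrite mul0r; exact: cvg_cst.
    by apply: cvgM; [exact: cvg_cst|apply: conv_poisson_cvg => //; exact: cf].
  - by [].
  - exact: (L1Z _ (L1_norm Lf)).
  - move=> n x _; rewrite /= lee_fin normrM mulrC ler_wpM2r//.
    by apply: conv_poisson_bound => //; exact: harmonic_gt0.
have cv2 := abel_energy_cvg Lf.
rewrite /real_isometric -(cvg_lim _ cv2)//; apply/cvg_lim => //.
rewrite -mulrA EFinM; under eq_fun do rewrite EFinM.
apply: cvgeM => //; exact: cvg_cst.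
Qed.


(** Young's inequality; a plays the role of a small parameter when u is the main
term and v an error. *)
Lemma young_sq (u v a : R) : 0 < a -> (u + v) ^+ 2 <= (1 + a) * u ^+ 2 + (1 + a^-1) * v ^+ 2.
Proof.
move=> a0; rewrite -subr_ge0.
have -> : (1 + a) * u ^+ 2 + (1 + a^-1) * v ^+ 2 - (u + v) ^+ 2 =
  a * (u - v / a) ^+ 2 by field; rewrite gt_eqF.
by rewrite mulr_ge0 ?sqr_ge0 ?ltW.
Qed.

Lemma young_sq2 (u v u' v' a : R) : 0 < a -> u' ^+ 2 + v' ^+ 2 <=
  (1 + a) * (u ^+ 2 + v ^+ 2) + (1 + a^-1) * ((u - u') ^+ 2 + (v - v') ^+ 2).
Proof.
move=> a0; have := young_sq u (u' - u) a0; have := young_sq v (v' - v) a0.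
rewrite !(addrC _ (_ - _)) !subrK -(sqrrN (u' - u)) -(sqrrN (v' - v)) !opprB => i1 i2.
by rewrite !mulrDr addrACA lerD.
Qed.

Lemma cosTB f h x : L1 f -> L1 h -> cosT (fun y => f y - h y) x = cosT f x - cosT h x.
Proof.
move=> Lf Lh; have mx : measurable_fun setT (fun y : R => x * y) by exact: measurable_funM.
rewrite /cosT -RintegralB//; [|exact: L1_mul_cos..].
by apply: eq_Rintegral => y _; rewrite mulrBl.
Qed.

Lemma sinTB f h x : L1 f -> L1 h -> sinT (fun y => f y - h y) x = sinT f x - sinT h x.
Proof.
move=> Lf Lh; have mx : measurable_fun setT (fun y : R => x * y) by exact: measurable_funM.
rewrite /sinT -RintegralB//; [|exact: L1_mul_sin..].
by apply: eq_Rintegral => y _; rewrite mulrBl.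
Qed.

Lemma L1_sqB f h : measurable_fun setT f -> measurable_fun setT h ->
  L1 (fun x => f x ^+ 2) -> L1 (fun x => h x ^+ 2) -> L1 (fun x => (f x - h x) ^+ 2).
Proof.
move=> mf mh Lf Lh; apply: (le_L1 _ _ (L1D (L1Z 2 Lf) (L1Z 2 Lh))).
  by apply: measurable_funX; exact: measurable_funB.
have q0 (u : R) : 0 <= 2 * u ^+ 2 by rewrite mulr_ge0 ?sqr_ge0.
move=> x; rewrite (ger0_norm (sqr_ge0 _)) (ger0_norm (addr_ge0 (q0 _) (q0 _))).
by have := @young_sq (f x) (- h x) 1 ltr01; rewrite invr1 sqrrN.
Qed.

(** With A, B, G, g, H, h standing for the integrals of the energy of f, of f^2, of
the square and the energy of the error, of the square and the energy of the
approximation.  The bound a^2 on the error compensates the factor c = 1 + 1 / a. *)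
Lemma real_isometric_closed_arith (a p A B G g H h c : R) : 0 < a -> a <= 1 -> 0 <= p -> 0 <= A ->
  c * a ^+ 2 = a ^+ 2 + a -> 0 <= c ->
  B <= (1 + a) * H + c * G -> G <= a ^+ 2 ->
  h <= (1 + a) * A + c * g -> g <= 2 * p * a ^+ 2 ->
  h = 2 * p * H -> 2 * p * B <= A + a * (3 * A + 12 * p).
Proof.
move=> a0 a1 p0 A0 ca c0 hB hG hh hg hE.
have a2 : a ^+ 2 <= a by rewrite expr2 ler_piMl// ltW.
have i1 : c * G <= 2 * a by apply: (le_trans (ler_wpM2l c0 hG)); rewrite ca; lra.
have i2 : c * g <= 4 * (p * a).
  apply: (le_trans (ler_wpM2l c0 hg)).
  have -> : c * (2 * p * a ^+ 2) = 2 * (p * (c * a ^+ 2)) by ring.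
  rewrite ca; have -> : 4 * (p * a) = 2 * (p * (a + a)) by ring.
  by rewrite ler_wpM2l// ler_wpM2l// lerD2r.
have h3 : h <= (1 + a) * A + 4 * (p * a) by apply: (le_trans hh); rewrite lerD2l.
have h4 : 2 * p * B <= (1 + a) * h + 4 * (p * a).
  have -> : (1 + a) * h + 4 * (p * a) = 2 * p * ((1 + a) * H + 2 * a) by rewrite hE; ring.
  by rewrite ler_wpM2l ?mulr_ge0// (le_trans hB)// lerD2l.
apply: (le_trans h4).
have a10 : 0 <= 1 + a by rewrite addr_ge0// ltW.
have h5 := ler_wpM2l a10 h3.
have j1 : a ^+ 2 * A <= a * A by rewrite ler_wpM2r.
have j2 : a ^+ 2 * p <= a * p by rewrite ler_wpM2r.
have e1 : (1 + a) * ((1 + a) * A + 4 * (p * a)) = A + 2 * (a * A) + a ^+ 2 * A +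
    4 * (a * p) + 4 * (a ^+ 2 * p) by ring.
have e2 : a * (3 * A + 12 * p) = 3 * (a * A) + 12 * (a * p) by ring.
rewrite e2 (mulrC p a); rewrite e1 in h5; lra.
Qed.

(** Both sides of Plancherel's identity are continuous in mean square: for the
integral of the energy this is the inequality [energy_integral_le] applied to the
error f - h. *)
Lemma real_isometric_closed f : L1 f -> L1 (fun x => f x ^+ 2) ->
  (forall e, 0 < e -> exists h, [/\ L1 h, L1 (fun x => h x ^+ 2), real_isometric h &
     \int[mu]_x ((f x - h x) ^+ 2) <= e]) ->
  real_isometric f.
Proof.
move=> Lf Lf2 H; have LE := L1_energy Lf Lf2.
have EE : (\int[mu]_x (energy f x)%:E = (\int[mu]_x energy f x)%:E)%E.
  by rewrite /Rintegral fineK//; exact: integrable_fin_num.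
have := energy_integral_le Lf Lf2; rewrite /real_isometric EE lee_fin => ub.
congr EFin; apply/eqP; rewrite eq_le ub/=.
set A := (X in _ <= X); set B := \int[mu]_x (f x ^+ 2).
have A0 : 0 <= A by apply: Rintegral_ge0 => x _; exact: energy_ge0.
have p0 : 0 < pi :> R := pi_gt0 R.
have key (a : R) : 0 < a -> a <= 1 -> 2 * pi * B <= A + a * (3 * A + 12 * pi).
  (* the error a^2 absorbs the factor 1 + 1 / a of Young's inequality *)
  move=> a0 a1; have [h [Lh Lh2 ih he]] := H (a ^+ 2) (exprn_gt0 2 a0).
  have [mf mh] := (L1_measurable Lf, L1_measurable Lh).
  pose g x := f x - h x.
  have Lg : L1 g by exact: L1B.
  have Lg2 : L1 (fun x => g x ^+ 2) by exact: L1_sqB.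
  have Eh : \int[mu]_x energy h x = 2 * pi * \int[mu]_x (h x ^+ 2).
    by rewrite /Rintegral ih.
  have Eg : \int[mu]_x energy g x <= 2 * pi * a ^+ 2.
    apply: (@le_trans _ _ (2 * pi * \int[mu]_x (g x ^+ 2))).
      rewrite -lee_fin; have := energy_integral_le Lg Lg2.
      by rewrite {2}/Rintegral fineK//; apply: integrable_fin_num => //; exact: L1_energy.
    by rewrite ler_wpM2l// mulr_ge0// ltW.
  have h1 : B <= (1 + a) * \int[mu]_x (h x ^+ 2) + (1 + a^-1) * \int[mu]_x (g x ^+ 2).
    rewrite -!RintegralZl// -RintegralD//; [|exact: L1Z..].
    apply: le_Rintegral => //; first by apply: L1D; exact: L1Z.
    by move=> x _; have := young_sq (h x) (g x) a0; rewrite /g addrC subrK.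
  have h2 : \int[mu]_x energy h x <= (1 + a) * A + (1 + a^-1) * \int[mu]_x energy g x.
    have LEg := L1_energy Lg Lg2.
    rewrite -!RintegralZl// -RintegralD//; [|exact: L1Z..].
    apply: le_Rintegral => //; [exact: L1_energy|by apply: L1D; exact: L1Z|].
    move=> x _; rewrite /energy cosTB// sinTB//.
    exact: young_sq2.
  have aV : (1 + a^-1) * a ^+ 2 = a ^+ 2 + a by field; rewrite gt_eqF.
  have aV0 : 0 <= 1 + a^-1 by rewrite addr_ge0// invr_ge0 ltW.
  apply: (@real_isometric_closed_arith a pi A B _ _ (\int[mu]_x (h x ^+ 2))
    (\int[mu]_x energy h x) _ a0 a1 (ltW p0) A0 aV aV0 h1 he h2 Eg Eh).
apply/ler_addgt0Pr => e e0.
pose K := 3 * A + 12 * pi.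
have K0 : 0 < K by rewrite ltr_wpDl// ?mulr_ge0// mulr_gt0.
(* small enough for a K <= e, and at most 1 as [key] requires *)
pose a := Num.min 1 (e / K).
have a0 : 0 < a by rewrite lt_min ltr01 divr_gt0.
apply: (le_trans (key a a0 _)); first by rewrite ge_min lexx.
by rewrite lerD2l -ler_pdivlMr// ge_min lexx orbT.
Qed.

End AbelLimit.

Section RealPlancherel.
Context {R : realType}.
Local Notation mu := (@lebesgue_measure R).
Implicit Types f h : R -> R.

Lemma L1_indic_itv (k : R) : L1 (\1_(`]- k, k[%classic : set R) : R -> R).
Proof. exact: integrable_indic_itv. Qed.

(** Clipping to [- M, M] fixes u and is a contraction. *)
Lemma clip_le (M u v : R) : `|u| <= M ->
  `|u - Num.max (- M) (Num.min M v)| <= `|u - v|.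
Proof.
rewrite ler_norml => /andP[h1 h2].
have [Mv|Mv] := leP M v.
  rewrite max_r; last lra.
  by rewrite !ler0_norm; lra.
have [Mv'|Mv'] := leP v (- M).
  by rewrite !ger0_norm; lra.
by [].
Qed.

Lemma clip_norm (M v : R) : 0 <= M -> `|Num.max (- M) (Num.min M v)| <= M.
Proof.
by move=> M0; rewrite ler_norml le_max lexx/= ge_max ge_min lexx/=; lra.
Qed.

(** Approximate f in mean by continuous functions on the interval, and clip them at
the bound M of f: for functions bounded by M, convergence in mean implies
convergence in mean square. *)
Lemma real_isometric_bounded f (M k : R) : measurable_fun setT f -> (forall y, `|f y| <= M) ->
  (forall x, ~~ (- k < x < k) -> f x = 0) -> real_isometric f.
Proof.
move=> mf fM f0.
have M0 : 0 <= M := le_trans (normr_ge0 _) (fM 0).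
pose I := `]- k, k[%classic : set R.
have Lbd h : measurable_fun setT h -> (forall y, `|h y| <= M) ->
    (forall x, ~~ (- k < x < k) -> h x = 0) -> L1 h /\ L1 (fun x => h x ^+ 2).
  move=> mh hM h0.
  have Lh : L1 h.
    apply: (le_L1 mh _ (L1Z M (L1_indic_itv k))) => x.
    rewrite indicE mem_setE in_itv/=.
    have [kx|kx] := boolP (- k < x < k); last by rewrite h0// normr0.
    by rewrite mulr1 (ger0_norm M0).
  by split=> //; apply: (eq_L1 _ (L1M Lh mh hM)) => x; rewrite expr2.
have [Lf Lf2] := Lbd _ mf fM f0.
apply: real_isometric_closed => // e e0.
have mI : measurable I by exact: measurable_itv.
have LfI : mu.-integrable I (EFin \o f) by apply: integrableS Lf.
have muI : (mu I < +oo)%E.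
  by rewrite /I lebesgue_measure_itv/=; case: ifPn => // _; rewrite -EFinD ltry.
have [g_ [cg ig g0]] := approximation_continuous_integrable mI muI LfI.
have M1 : 0 < 2 * M + 1 by rewrite ltr_wpDl// mulr_ge0.
have e2 : 0 < e / (2 * M + 1) by rewrite divr_gt0.
have [[N1 _ fin1] /cvgr_lt /(_ _ e2) [N2 _ lt2]] := (fine_cvgP _ _).1 g0.
pose N := maxn N1 N2; have {}fin1 := fin1 N (leq_maxl _ _).
have {}lt2 := lt2 N (leq_maxr _ _).
pose g := g_ N.
(* the continuous approximation clipped to the range of f *)
pose c x := Num.max (- M) (Num.min M (g x)).
have cc : continuous c.
  move=> x; apply: (@continuous_max R R (cst (- M)) (fun x => Num.min M (g x))).
    exact: cvg_cst.
  apply: (@continuous_min R R (cst M) g); first exact: cvg_cst.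
  exact: cg.
pose h x := c x * \1_I x.
have mh : measurable_fun setT h.
  by apply: measurable_funM; [exact: continuous_measurable_fun|exact: measurable_indic].
have hM y : `|h y| <= M.
  rewrite /h indicE; case: (y \in I); last by rewrite mulr0 normr0.
  by rewrite mulr1 clip_norm.
have h0 x : ~~ (- k < x < k) -> h x = 0.
  by move=> kx; rewrite /h indicE mem_setE in_itv/= (negbTE kx) mulr0.
have [Lh Lh2] := Lbd _ mh hM h0.
exists h; split => //.
  apply: (real_isometric_continuous_itv mh hM h0) => x kx.
  have : {for x, continuous c} by exact: cc.
  have hcx : h x = c x by rewrite /h indicE mem_setE in_itv/= kx mulr1.
  rewrite /prop_for /continuous_at hcx; apply: cvg_trans; apply: near_eq_cvg.
  have : x \in `]- k, k[ by rewrite in_itv.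
  move/near_in_itvoo; apply: filterS => y yI.
  by rewrite /h indicE mem_setE yI mulr1.
(* 2 M bounds |f - h|; adding 1 keeps the constant positive when M = 0 *)
have fh x : (f x - h x) ^+ 2 <= (2 * M + 1) * (`|f x - g x| * \1_I x).
  rewrite -(real_normK (num_real _)) /h indicE mem_setE in_itv/=.
  have [kx|kx] := boolP (- k < x < k); last first.
    by rewrite !mulr0 f0// subr0 normr0 expr0n.
  rewrite !mulr1 expr2; apply: ler_pM => //; last exact: clip_le.
  apply: (le_trans (ler_normB _ _)).
  have := fM x; have := clip_norm (g x) M0; rewrite -/(c x); lra.
have Efg : (\int[mu]_x (`|f x - g x| * \1_I x)%:E = \int[mu]_(x in I) `|(f x - g x)%:E|)%E.
  rewrite [RHS]integral_mkcond; apply: eq_integral => x _.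
  by rewrite patchE indicE; case: (x \in I); rewrite ?mulr1 ?mulr0.
have Lfg : L1 (fun x => `|f x - g x| * \1_I x).
  apply/integrableP; split.
    apply/measurable_EFinP; apply: measurable_funM; last exact: measurable_indic.
    apply: measurableT_comp => //; apply: measurable_funB => //.
    by apply: continuous_measurable_fun; exact: cg.
  under eq_integral do rewrite /= ger0_norm ?mulr_ge0//.
  by rewrite Efg ltey_eq fin1.
apply: (@le_trans _ _ (\int[mu]_x ((2 * M + 1) * (`|f x - g x| * \1_I x)))).
  apply: le_Rintegral => //; last exact: L1Z.
  by apply: L1_sqB => //; exact: L1_measurable.
rewrite RintegralZl// mulrC -ler_pdivlMr// ltW//.
by rewrite /Rintegral Efg.
Qed.

(** Cut f off where |x| or |f x| is large; the squared errors are dominated by f^2. *)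
Lemma truncation f e : L1 f -> L1 (fun x => f x ^+ 2) -> 0 < e ->
  exists (M : R) (h : R -> R), [/\ measurable_fun setT h, forall x, `|h x| <= M,
    forall x, ~~ (- M < x < M) -> h x = 0, forall x, `|h x| <= `|f x| &
    \int[mu]_x ((f x - h x) ^+ 2) <= e].
Proof.
move=> Lf Lf2 e0; have mf := L1_measurable Lf.
pose S (k : nat) := [set x : R | (- k%:R < x < k%:R) && (`|f x| <= k%:R)].
have mS k : measurable (S k).
  rewrite (_ : S k = `]- k%:R, k%:R[%classic `&` (setT `&` f @^-1` `[- k%:R, k%:R])).
    by apply: measurableI => //; exact: mf.
  apply/seteqP; split => x; rewrite /S /= !in_itv/= -ler_norml.
    by move=> /andP[].
  by move=> [h1 [_ h2]]; rewrite h1 h2.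
pose D k x := (f x - f x * \1_(S k) x) ^+ 2.
have DE k x : D k x = f x ^+ 2 * \1_(~` S k) x.
  rewrite /D !indicE in_setC; case: (x \in S k) => /=.
    by rewrite mulr1 subrr expr0n mulr0.
  by rewrite mulr0 subr0 mulr1.
have mD k : measurable_fun setT (D k).
  rewrite (_ : D k = fun x => f x ^+ 2 * \1_(~` S k) x); last by apply/funext.
  apply: measurable_funM; first exact: measurable_funX.
  by apply: measurable_indic; exact: measurableC.
have LD k : L1 (D k).
  apply: (le_L1 (mD k) _ Lf2) => x; rewrite DE normrM ler_piMr// indicE.
  by case: (x \in _); rewrite ?normr1 ?normr0.
have : (\int[mu]_x (D k x)%:E @[k --> \oo] --> \int[mu]_x (cst 0%:E x))%E.
  apply: (@dominated_cvg _ _ _ mu _ measurableT (fun k x => (D k x)%:E) _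
    (fun x => (f x ^+ 2)%:E)).
  - by move=> k; apply/measurable_EFinP; exact: mD.
  - move=> x _; apply: cvg_near_cst.
    have [N hN] : exists N : nat, `|x| + `|f x| < N%:R.
      by exists (Num.truncn (`|x| + `|f x|)).+1; rewrite truncnS_gt.
    exists N => // k /= Nk; congr EFin; rewrite DE indicE in_setC mem_set ?mulr0//=.
    have Nk' : N%:R <= k%:R :> R by rewrite ler_nat.
    rewrite /S /= -ltr_norml; apply/andP; split.
      by have := normr_ge0 (f x); lra.
    by have := normr_ge0 x; lra.
  - by [].
  - exact: Lf2.
  - move=> k x _; rewrite lee_fin DE normrM (ger0_norm (sqr_ge0 _)) ler_piMr ?sqr_ge0// indicE.
    by case: (x \in _); rewrite ?normr1 ?normr0.
rewrite integral0 => /fine_cvgP [_ /cvgr_lt /(_ _ e0) [k _ hk]].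
exists k%:R, (fun x => f x * \1_(S k) x); split.
- by apply: measurable_funM => //; exact: measurable_indic.
- move=> x; rewrite indicE; have [|_] := boolP (x \in S k); last by rewrite mulr0 normr0.
  by rewrite inE /S/= => /andP[_ fk]; rewrite mulr1.
- move=> x xk; rewrite indicE memNset ?mulr0//.
  by rewrite /S/= => /andP[xk' _]; rewrite xk' in xk.
- move=> x; rewrite normrM ler_piMr// indicE.
  by case: (x \in _); rewrite ?normr1 ?normr0.
- by apply: ltW; exact: (hk k (leqnn k)).
Qed.

Theorem plancherel_real f : L1 f -> L1 (fun x => f x ^+ 2) -> real_isometric f.
Proof.
move=> Lf Lf2; have mf := L1_measurable Lf.
apply: real_isometric_closed => // e e0.
have [M [h [mh hM h0 hf hk]]] := truncation Lf Lf2 e0.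
have Lh := le_L1 mh hf Lf.
exists h; split=> //; last exact: real_isometric_bounded hM h0.
apply: (le_L1 _ _ Lf2); first exact: measurable_funX.
by move=> x; rewrite !normrX ler_pXn2r ?nnegrE.
Qed.

End RealPlancherel.

(** * Complex-valued integrable and square-integrable functions *)

Section ComplexSquare.
Context {R : realType}.
Implicit Types z w : R[i].

(** A polynomial in the real and imaginary parts, hence easier to integrate than
the square of [normc]. *)
Definition normsq z : R := complex.Re z ^+ 2 + complex.Im z ^+ 2.

Lemma normsq_ge0 z : 0 <= normsq z. Proof. by rewrite addr_ge0 ?sqr_ge0. Qed.

Lemma normsq_normc z : normsq z = normc z ^+ 2.
Proof. by case: z => a b; rewrite /normsq /= sqr_sqrtr// addr_ge0 ?sqr_ge0. Qed.

Lemma normsqM z w : normsq (z * w) = normsq z * normsq w.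
Proof. by rewrite !normsq_normc normcM exprMn. Qed.

Lemma normsq_expi (theta : R) : normsq (expi theta) = 1.
Proof. by rewrite /normsq /= cos2Dsin2. Qed.

Lemma normsqD_le z w : normsq (z + w) <= 2 * normsq z + 2 * normsq w.
Proof.
case: z => a b; case: w => c d; rewrite /normsq /= -subr_ge0.
have -> : 2 * (a ^+ 2 + b ^+ 2) + 2 * (c ^+ 2 + d ^+ 2) - ((a + c) ^+ 2 + (b + d) ^+ 2) =
  (a - c) ^+ 2 + (b - d) ^+ 2 by ring.
by rewrite addr_ge0 ?sqr_ge0.
Qed.

Lemma cReM z w : complex.Re (z * w) = complex.Re z * complex.Re w - complex.Im z * complex.Im w.
Proof. by case: z => a b; case: w. Qed.

Lemma cImM z w : complex.Im (z * w) = complex.Re z * complex.Im w + complex.Im z * complex.Re w.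
Proof. by case: z => a b; case: w. Qed.

Lemma Re_realM (r : R) z : complex.Re (r%:C%C * z) = r * complex.Re z.
Proof. by case: z => a b /=; ring. Qed.

Lemma Im_realM (r : R) z : complex.Im (r%:C%C * z) = r * complex.Im z.
Proof. by case: z => a b /=; ring. Qed.

Lemma cReD z w : complex.Re (z + w) = complex.Re z + complex.Re w.
Proof. by case: z => a b; case: w. Qed.

Lemma cImD z w : complex.Im (z + w) = complex.Im z + complex.Im w.
Proof. by case: z => a b; case: w. Qed.

Lemma cReN z : complex.Re (- z) = - complex.Re z. Proof. by case: z. Qed.
Lemma cImN z : complex.Im (- z) = - complex.Im z. Proof. by case: z. Qed.

Lemma complexP z w : complex.Re z = complex.Re w -> complex.Im z = complex.Im w -> z = w.
Proof. by case: z => a b; case: w => c d /= -> ->. Qed.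

(** Polarization. *)
Lemma Re_mul_conj z w : complex.Re (z * w^*%C) = (normsq (z + w) - normsq z - normsq w) / 2.
Proof. by case: z => a b; case: w => c d; rewrite /normsq /=; field. Qed.

(** Reduces imaginary parts of inner products to real parts, replacing one factor
by its product with - i. *)
Lemma Im_mul_conj z w : complex.Im (z * w^*%C) = complex.Re (- 'i%C * z * w^*%C).
Proof. by case: z => a b; case: w => c d /=; ring. Qed.

Lemma expiD (a b : R) : expi (a + b) = expi a * expi b.
Proof. by apply: complexP => /=; rewrite ?cosD ?sinD//; ring. Qed.

Lemma expi0 : expi 0 = 1 :> R[i].
Proof. by rewrite /expi cos0 sin0. Qed.

End ComplexSquare.

Section ComplexFunctions.
Context {R : realType}.
Local Notation mu := (@lebesgue_measure R).
Implicit Types F G : R -> R[i].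

Definition cL1 F :=
  L1 (fun x => complex.Re (F x)) /\ L1 (fun x => complex.Im (F x)).

(** The domain on which the Fourier integral converges absolutely and Plancherel's
identity makes sense. *)
Definition cL1L2 F := cL1 F /\ L1 (fun x => normsq (F x)).

Lemma cL1_measurable F : cL1 F -> cmeasurable F.
Proof. by move=> [/L1_measurable h1 /L1_measurable h2]. Qed.

Lemma cmeasurableD F G : cmeasurable F -> cmeasurable G -> cmeasurable (fun x => F x + G x).
Proof.
move=> [f1 f2] [g1 g2]; split.
  by under eq_fun do rewrite cReD; exact: measurable_funD.
by under eq_fun do rewrite cImD; exact: measurable_funD.
Qed.

Lemma cmeasurableN F : cmeasurable F -> cmeasurable (fun x => - F x).
Proof.
move=> [f1 f2]; split.
  by under eq_fun do rewrite cReN; exact: measurableT_comp.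
by under eq_fun do rewrite cImN; exact: measurableT_comp.
Qed.

Lemma cmeasurableB F G : cmeasurable F -> cmeasurable G -> cmeasurable (fun x => F x - G x).
Proof. by move=> mF mG; apply: cmeasurableD => //; exact: cmeasurableN. Qed.

Lemma cmeasurableM F G : cmeasurable F -> cmeasurable G -> cmeasurable (fun x => F x * G x).
Proof.
move=> [f1 f2] [g1 g2]; split.
  by under eq_fun do rewrite cReM; apply: measurable_funB; exact: measurable_funM.
by under eq_fun do rewrite cImM; apply: measurable_funD; exact: measurable_funM.
Qed.

Lemma cmeasurable_expi (h : R -> R) : measurable_fun setT h -> cmeasurable (fun x => expi (h x)).
Proof. by split; [exact: measurable_cos_comp|exact: measurable_sin_comp]. Qed.

Lemma measurable_normsq F : cmeasurable F -> measurable_fun setT (fun x => normsq (F x)).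
Proof. by move=> [f1 f2]; apply: measurable_funD; exact: measurable_funX. Qed.

Lemma cL1L2_sq F : cL1L2 F ->
  L1 (fun x => complex.Re (F x) ^+ 2) /\ L1 (fun x => complex.Im (F x) ^+ 2).
Proof.
move=> [/cL1_measurable[f1 f2] L2]; split.
  apply: (le_L1 _ _ L2); first exact: measurable_funX.
  by move=> x; rewrite !ger0_norm ?normsq_ge0 ?sqr_ge0// /normsq lerDl sqr_ge0.
apply: (le_L1 _ _ L2); first exact: measurable_funX.
by move=> x; rewrite !ger0_norm ?normsq_ge0 ?sqr_ge0// /normsq lerDr sqr_ge0.
Qed.

Lemma L1_normsqD F G : cmeasurable F -> cmeasurable G ->
  L1 (fun x => normsq (F x)) -> L1 (fun x => normsq (G x)) -> L1 (fun x => normsq (F x + G x)).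
Proof.
move=> mF mG LF LG; apply: (le_L1 _ _ (L1D (L1Z 2 LF) (L1Z 2 LG))).
  by apply: measurable_normsq; exact: cmeasurableD.
by move=> x; rewrite ger0_norm ?normsq_ge0// (le_trans (normsqD_le _ _))// ler_norm.
Qed.

Lemma cL1D F G : cL1 F -> cL1 G -> cL1 (fun x => F x + G x).
Proof.
move=> [f1 f2] [g1 g2]; split.
  by under eq_fun do rewrite cReD; exact: L1D.
by under eq_fun do rewrite cImD; exact: L1D.
Qed.

Lemma cL1M_bounded F G : cL1 F -> cmeasurable G -> (forall x, normsq (G x) <= 1) ->
  cL1 (fun x => F x * G x).
Proof.
move=> [f1 f2] [g1 g2] G1.
have R1 x : `|complex.Re (G x)| <= 1.
  rewrite -(@ler_pXn2r _ 2) ?nnegrE// expr1n real_normK ?num_real//.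
  by apply: le_trans (G1 x); rewrite /normsq lerDl sqr_ge0.
have I1 x : `|complex.Im (G x)| <= 1.
  rewrite -(@ler_pXn2r _ 2) ?nnegrE// expr1n real_normK ?num_real//.
  by apply: le_trans (G1 x); rewrite /normsq lerDr sqr_ge0.
split.
  by under eq_fun do rewrite cReM; apply: L1B; exact: L1M.
by under eq_fun do rewrite cImM; apply: L1D; exact: L1M.
Qed.

Lemma cL1Z (c : R[i]) F : cL1 F -> cL1 (fun x => c * F x).
Proof.
move=> [f1 f2]; split.
  by under eq_fun do rewrite cReM; apply: L1B; exact: L1Z.
by under eq_fun do rewrite cImM; apply: L1D; exact: L1Z.
Qed.

Lemma cL1_expi F (h : R -> R) : cL1 F -> measurable_fun setT h ->
  cL1 (fun x => F x * expi (h x)).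
Proof.
move=> LF mh; apply: cL1M_bounded => //; first exact: cmeasurable_expi.
by move=> x; rewrite normsq_expi.
Qed.

Lemma cL1L2D F G : cL1L2 F -> cL1L2 G -> cL1L2 (fun x => F x + G x).
Proof.
move=> [F1 F2] [G1 G2]; split; first exact: cL1D.
by apply: L1_normsqD => //; exact: cL1_measurable.
Qed.

Lemma cL1L2Z (c : R[i]) F : cL1L2 F -> cL1L2 (fun x => c * F x).
Proof.
move=> [F1 F2]; split; first exact: cL1Z.
by under eq_fun do rewrite normsqM; exact: L1Z.
Qed.

Lemma cL1L2N F : cL1L2 F -> cL1L2 (fun x => - F x).
Proof. by move=> /(cL1L2Z (-1)); under eq_fun do rewrite mulN1r. Qed.

Lemma cL1L2B F G : cL1L2 F -> cL1L2 G -> cL1L2 (fun x => F x - G x).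
Proof. by move=> LF LG; apply: cL1L2D => //; exact: cL1L2N. Qed.

Lemma cL1L2_expi F (h : R -> R) : cL1L2 F -> measurable_fun setT h ->
  cL1L2 (fun x => F x * expi (h x)).
Proof.
move=> [F1 F2] mh; split; first exact: cL1_expi.
by under eq_fun do rewrite normsqM normsq_expi mulr1.
Qed.

Lemma cL1L2_zero : cL1L2 (fun=> 0).
Proof.
have L0 : L1 (fun=> 0 : R) by exact: integrable0.
by split => //; under eq_fun do rewrite /normsq /= !expr0n addr0.
Qed.

Lemma cL1L2_sum (n : nat) (u : nat -> R -> R[i]) : (forall k, cL1L2 (u k)) ->
  cL1L2 (fun x => \sum_(k < n) u k x).
Proof.
move=> Lu; elim: n => [|n IH].
  by under eq_fun do rewrite big_ord0; exact: cL1L2_zero.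
by under eq_fun do rewrite big_ord_recr /=; exact: cL1L2D.
Qed.

Lemma cintegralD F G : cL1 F -> cL1 G ->
  cintegral (fun x => F x + G x) = cintegral F + cintegral G.
Proof.
move=> [f1 f2] [g1 g2]; apply: complexP; rewrite ?cReD ?cImD /=.
  by rewrite -RintegralD//; apply: eq_Rintegral => x _; rewrite cReD.
by rewrite -RintegralD//; apply: eq_Rintegral => x _; rewrite cImD.
Qed.

Lemma cintegralZ (c : R[i]) F : cL1 F ->
  cintegral (fun x => c * F x) = c * cintegral F.
Proof.
move=> [f1 f2]; apply: complexP; rewrite ?cReM ?cImM /=.
  rewrite -!RintegralZl// -RintegralB//; [|exact: L1Z..].
  by apply: eq_Rintegral => x _; rewrite cReM.
rewrite -!RintegralZl// -RintegralD//; [|exact: L1Z..].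
by apply: eq_Rintegral => x _; rewrite cImM.
Qed.

Lemma eq_cintegral F G : F =1 G -> cintegral F = cintegral G.
Proof. by move=> /funext ->. Qed.

End ComplexFunctions.

Section L2.
Context {R : realType}.
Local Notation mu := (@lebesgue_measure R).
Implicit Types F G : R -> R[i].

(** Bounds on the norm are exchanged for bounds on its square, which is additive
over integrals. *)
Lemma L2norm_lt F (e : R) : 0 < e ->
  (L2norm F < e%:E)%E = (\int[mu]_x (normsq (F x))%:E < (e ^+ 2)%:E)%E.
Proof.
move=> e0; rewrite /L2norm unlock /Lnorm.
have -> : (\int[mu]_x (`|(normc (F x))%:E| `^ 2) = \int[mu]_x (normsq (F x))%:E)%E.
  apply: eq_integral => x _; rewrite normsq_normc /=; congr EFin.
  by rewrite powR_mulrn// real_normK// num_real.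
have : (0 <= \int[mu]_x (normsq (F x))%:E)%E.
  by apply: integral_ge0 => x _; rewrite lee_fin normsq_ge0.
case: (\int[mu]_x _)%E => [r|_|//]; last by rewrite (eqy_poweR _ erefl) ?invr_gt0// !ltNge !leey.
rewrite !lee_fin => r0; rewrite poweR12_sqrt ?lee_fin//= !lte_fin.
by rewrite -[in RHS](sqr_sqrtr r0) ltr_pXn2r ?nnegrE ?sqrtr_ge0 ?ltW.
Qed.

Lemma L2norm_lty F : L1 (fun x => normsq (F x)) -> (L2norm F < +oo)%E.
Proof.
move=> LF; have /integrable_lty : mu.-integrable setT (fun x => (normsq (F x))%:E) by [].
move=> /(_ measurableT) => h.
have h0 : 0 <= \int[mu]_x normsq (F x) by apply: Rintegral_ge0 => x _; exact: normsq_ge0.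
pose e := \int[mu]_x normsq (F x) + 1.
apply: (@lt_trans _ _ e%:E); last by rewrite ltry.
rewrite L2norm_lt ?ltr_wpDl//.
have -> : (\int[mu]_x (normsq (F x))%:E)%E = (\int[mu]_x normsq (F x))%:E.
  by rewrite /Rintegral fineK//; exact: integrable_fin_num.
by rewrite lte_fin /e; nra.
Qed.

Lemma Re_L2inner F G : cmeasurable F -> cmeasurable G ->
  L1 (fun x => normsq (F x)) -> L1 (fun x => normsq (G x)) ->
  complex.Re (L2inner F G) =
  (\int[mu]_x normsq (F x + G x) - \int[mu]_x normsq (F x) - \int[mu]_x normsq (G x)) / 2.
Proof.
move=> mF mG LF LG; rewrite /L2inner /=.
under eq_Rintegral do rewrite Re_mul_conj.
have LFG := L1_normsqD mF mG LF LG.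
rewrite RintegralZr//; last by apply: L1B => //; exact: L1B.
by rewrite !RintegralB//; exact: L1B.
Qed.

Lemma Im_L2inner F G :
  complex.Im (L2inner F G) = complex.Re (L2inner (fun x => - 'i%C * F x) G).
Proof. by rewrite /L2inner /=; apply: eq_Rintegral => x _; rewrite Im_mul_conj. Qed.

End L2.

(** * Plancherel and Parseval for complex functions *)

Section Fourier.
Context {R : realType}.
Local Notation mu := (@lebesgue_measure R).
Implicit Types F G : R -> R[i].

Definition fourier F (x : R) : R[i] := cintegral (fun xi => F xi * expi (x * xi)).

Lemma measurable_mulx (x : R) : measurable_fun setT (fun y : R => x * y).
Proof. exact: measurable_funM. Qed.

Lemma Re_fourier F x : cL1 F -> complex.Re (fourier F x) =
  cosT (fun xi => complex.Re (F xi)) x - sinT (fun xi => complex.Im (F xi)) x.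
Proof.
move=> [F1 F2]; have mx := measurable_mulx x.
rewrite /cosT /sinT -RintegralB//; [|exact: L1_mul_cos|exact: L1_mul_sin].
transitivity (\int[mu]_xi complex.Re (F xi * expi (x * xi))) => //.
by congr Rintegral; apply/funext => xi; rewrite cReM.
Qed.

Lemma Im_fourier F x : cL1 F -> complex.Im (fourier F x) =
  sinT (fun xi => complex.Re (F xi)) x + cosT (fun xi => complex.Im (F xi)) x.
Proof.
move=> [F1 F2]; have mx := measurable_mulx x.
rewrite /cosT /sinT -RintegralD//; [|exact: L1_mul_sin|exact: L1_mul_cos].
transitivity (\int[mu]_xi complex.Im (F xi * expi (x * xi))) => //.
by congr Rintegral; apply/funext => xi; rewrite cImM.
Qed.

Lemma fourierD F G x : cL1 F -> cL1 G ->
  fourier (fun xi => F xi + G xi) x = fourier F x + fourier G x.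
Proof.
move=> LF LG; have mx := measurable_mulx x.
rewrite /fourier -cintegralD//; try exact: cL1_expi.
by apply: eq_cintegral => xi; rewrite mulrDl.
Qed.

Lemma fourierZ (c : R[i]) F x : cL1 F ->
  fourier (fun xi => c * F xi) x = c * fourier F x.
Proof.
move=> LF; have mx := measurable_mulx x.
rewrite /fourier -cintegralZ//; try exact: cL1_expi.
by apply: eq_cintegral => xi; rewrite mulrA.
Qed.

Lemma fourierB F G x : cL1 F -> cL1 G ->
  fourier (fun xi => F xi - G xi) x = fourier F x - fourier G x.
Proof.
move=> LF LG; rewrite -[in RHS]mulN1r -fourierZ// -fourierD//; last exact: cL1Z.
by congr (fourier _ x); apply/funext => xi; rewrite mulN1r.
Qed.

Lemma fourier_sum (n : nat) (u : nat -> R -> R[i]) x : (forall k, cL1L2 (u k)) ->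
  fourier (fun xi => \sum_(k < n) u k xi) x = \sum_(k < n) fourier (u k) x.
Proof.
move=> Lu; elim: n => [|n IH].
  rewrite big_ord0; have -> : (fun xi : R => \sum_(k < 0) u k xi) = (fun xi => 0 * cst 0 xi).
    by apply/funext => xi; rewrite big_ord0 mul0r.
  rewrite fourierZ; [exact: mul0r|exact: (proj1 cL1L2_zero)].
rewrite big_ord_recr /= -IH -fourierD//; last 2 first.
- by apply: proj1; exact: cL1L2_sum.
- by apply: proj1; exact: Lu.
by under [X in fourier X _]eq_fun do rewrite big_ord_recr /=.
Qed.

Lemma cosTN f (x : R) : cosT f (- x) = cosT f x.
Proof. by apply: eq_Rintegral => xi _; rewrite mulNr cosN. Qed.

Lemma sinTN f (x : R) : L1 f -> sinT f (- x) = - sinT f x.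
Proof.
move=> Lf; rewrite -[RHS]mulN1r /sinT -RintegralZl//; last first.
  by apply: L1_mul_sin => //; exact: measurable_mulx.
by apply: eq_Rintegral => xi _; rewrite mulNr sinN mulN1r mulrN.
Qed.

Lemma continuous_Re_fourier F : cL1 F -> continuous (fun x => complex.Re (fourier F x)).
Proof.
move=> LF; have [F1 F2] := LF; rewrite (_ : (fun x => _) = (fun x =>
  cosT (fun xi => complex.Re (F xi)) x - sinT (fun xi => complex.Im (F xi)) x)).
  by move=> x; apply: cvgB; [exact: continuous_cosT|exact: continuous_sinT].
by apply/funext => x; rewrite Re_fourier.
Qed.

Lemma continuous_Im_fourier F : cL1 F -> continuous (fun x => complex.Im (fourier F x)).
Proof.
move=> LF; have [F1 F2] := LF; rewrite (_ : (fun x => _) = (fun x =>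
  sinT (fun xi => complex.Re (F xi)) x + cosT (fun xi => complex.Im (F xi)) x)).
  by move=> x; apply: cvgD; [exact: continuous_sinT|exact: continuous_cosT].
by apply/funext => x; rewrite Im_fourier.
Qed.

Lemma continuous_normsq_fourier F : cL1 F -> continuous (fun x => normsq (fourier F x)).
Proof.
move=> LF; have sqc (h : R -> R) : continuous h -> continuous (fun x => h x ^+ 2).
  move=> ch x; apply: (@continuous_comp _ _ _ h (fun z => z ^+ 2)); first exact: ch.
  exact: exprn_continuous.
move=> x; apply: cvgD.
  exact: (sqc _ (continuous_Re_fourier LF) x).
exact: (sqc _ (continuous_Im_fourier LF) x).
Qed.

Lemma cmeasurable_fourier F : cL1 F -> cmeasurable (fourier F).
Proof.
move=> LF; split; apply: continuous_measurable_fun.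
  exact: continuous_Re_fourier.
exact: continuous_Im_fourier.
Qed.

(** Folding the line onto a half-line discards the odd part of the integrand. *)
Lemma ge0_integralT_fold (f : R -> R) : (forall x, 0 <= f x) -> continuous f ->
  (\int[mu]_x (f x)%:E = \int[mu]_(x in `[0%R, +oo[) (f x + f (- x))%:E)%E.
Proof.
move=> f0 cf; have mf : measurable_fun setT (fun x : R => (f x)%:E).
  by apply/measurable_EFinP; exact: continuous_measurable_fun.
rewrite -(setUv `[0%R, +oo[%classic) ge0_integral_setU//=; last 4 first.
- exact: measurableC.
- by rewrite setUv.
- by move=> x _; rewrite lee_fin.
- exact/disj_setPCl.
rewrite setCitvr integral_itv_bndo_bndc; last exact: measurable_funTS.
rewrite -{2}oppr0 ge0_integration_by_substitutionNy//; last exact: continuous_subspaceT.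
under [RHS]eq_integral do rewrite EFinD.
rewrite ge0_integralD//.
- by move=> x _; rewrite lee_fin.
- exact: measurable_funTS.
- by move=> x _; rewrite lee_fin.
- apply: measurable_funTS; apply/measurable_EFinP; apply: continuous_measurable_fun => x.
  by apply: (@continuous_comp R R R -%R f); [exact: opp_continuous|exact: cf].
Qed.

(** With a and b the real and imaginary parts of F, the squared modulus of the
transform is the energy of a plus that of b plus a cross term.  The cross term is
odd, because cosine transforms are even and sine transforms odd. *)
Lemma plancherel F : cL1L2 F ->
  (\int[mu]_x (normsq (fourier F x))%:E = (2 * pi * \int[mu]_x normsq (F x))%:E)%E.
Proof.
move=> LF; have [F1 F2] := LF; have [a1 b1] := F1; have [a2 b2] := cL1L2_sq LF.
set a := fun x => complex.Re (F x) in a1 a2; set b := fun x => complex.Im (F x) in b1 b2.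
have ce : continuous (fun x => energy a x + energy b x).
  by move=> x; apply: cvgD; exact: continuous_energy.
rewrite ge0_integralT_fold; [|by move=> x; exact: normsq_ge0|exact: continuous_normsq_fourier].
transitivity (\int[mu]_x (energy a x + energy b x)%:E)%E.
  rewrite [RHS]ge0_integralT_fold//; last by move=> x; rewrite addr_ge0 ?energy_ge0.
  apply: eq_integral => x _; congr EFin.
  rewrite /normsq !Re_fourier// !Im_fourier// /energy -/a -/b !cosTN !sinTN//; ring.
under eq_integral do rewrite EFinD.
rewrite ge0_integralD//; last 4 first.
- by move=> x _; rewrite lee_fin energy_ge0.
- by apply/measurable_EFinP; apply: continuous_measurable_fun; exact: continuous_energy.
- by move=> x _; rewrite lee_fin energy_ge0.
- by apply/measurable_EFinP; apply: continuous_measurable_fun; exact: continuous_energy.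
have -> := plancherel_real a1 a2; have -> := plancherel_real b1 b2.
by rewrite -EFinD -mulrDr -RintegralD.
Qed.

Lemma L1_normsq_fourier F : cL1L2 F -> L1 (fun x => normsq (fourier F x)).
Proof.
move=> LF; apply/integrableP; split.
  apply/measurable_EFinP; apply: continuous_measurable_fun.
  by apply: continuous_normsq_fourier; case: LF.
under eq_integral do rewrite /= ger0_norm ?normsq_ge0//.
by rewrite plancherel// ltry.
Qed.

Lemma inL2_fourier F : cL1L2 F -> inL2 (fourier F).
Proof.
move=> LF; split; first by apply: cmeasurable_fourier; case: LF.
by apply: L2norm_lty; exact: L1_normsq_fourier.
Qed.

Let Re_parseval F G : cL1L2 F -> cL1L2 G ->
  complex.Re (L2inner (fourier F) (fourier G)) = 2 * pi * complex.Re (L2inner F G).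
Proof.
move=> LF LG; have [F1 F2] := LF; have [G1 G2] := LG.
have [mF mG] := (cL1_measurable F1, cL1_measurable G1).
rewrite (Re_L2inner mF mG F2 G2) (Re_L2inner (cmeasurable_fourier F1)
  (cmeasurable_fourier G1) (L1_normsq_fourier LF) (L1_normsq_fourier LG)).
have pR H : cL1L2 H -> \int[mu]_x normsq (fourier H x) = 2 * pi * \int[mu]_x normsq (H x).
  by move=> LH; rewrite {1}/Rintegral plancherel.
under eq_Rintegral do rewrite -(fourierD _ F1 G1).
by rewrite (pR _ LF) (pR _ LG) (pR _ (cL1L2D LF LG)); ring.
Qed.

(** Polarization of Plancherel's identity. *)
Lemma parseval F G : cL1L2 F -> cL1L2 G ->
  L2inner (fourier F) (fourier G) = (2 * pi)%:C%C * L2inner F G.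
Proof.
move=> LF LG; apply: complexP; rewrite ?Re_realM ?Im_realM; first exact: Re_parseval.
rewrite !Im_L2inner -(Re_parseval (cL1L2Z _ LF) LG).
congr (complex.Re (L2inner _ _)); apply/funext => x.
by rewrite (fourierZ _ _ (proj1 LF)).
Qed.

End Fourier.

(** * Differentiation of oscillatory integrals *)

Section Differentiation.
Context {R : realType}.
Local Notation mu := (@lebesgue_measure R).

Section Real.
Variables (u v a c : R -> R).
Hypotheses (Lu : L1 u) (Lv : L1 v) (ma : measurable_fun setT a)
  (mc : measurable_fun setT c).
Hypotheses (Lau : L1 (fun x => a x * u x)) (Lav : L1 (fun x => a x * v x)).

Let k (s x : R) := u x * cos (s * a x + c x) + v x * sin (s * a x + c x).

Let dk (s x : R) : is_derive s 1 (fun s => k s x)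
  (a x * v x * cos (s * a x + c x) - a x * u x * sin (s * a x + c x)).
Proof.
have -> : (fun s => k s x) =
    (fun s => u x *: cos (s *: a x + c x) + v x *: sin (s *: a x + c x)) by [].
apply: is_derive_eq; rewrite /GRing.scale /=; ring.
Qed.

Let mphase (s : R) : measurable_fun setT (fun x => s * a x + c x).
Proof. by apply: measurable_funD => //; exact: measurable_funM. Qed.

(** Dominated differentiation under the integral sign; the derivative of the
integrand is bounded by |a v| + |a u| uniformly in s. *)
Lemma trig_integral_derive (s : R) :
  derivable (fun s => \int[mu]_x k s x) s 1 /\
  derive1 (fun s => \int[mu]_x k s x) s =
  \int[mu]_x (a x * v x * cos (s * a x + c x) - a x * u x * sin (s * a x + c x)).
Proof.
have Is : (`](s - 1), (s + 1)[%classic : set R) s.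
  by rewrite /= in_itv/= ltrBlDr ltrDl ltr01.
have Lk s' : L1 (k s').
  by apply: L1D; [exact: L1_mul_cos|exact: L1_mul_sin].
pose G x := `|a x * v x| + `|a x * u x|.
have LG : L1 G by apply: L1D; exact: L1_norm.
have G0 x : 0 <= G x by rewrite addr_ge0.
have d1 s' x : partial1of2 k s' x =
    a x * v x * cos (s' * a x + c x) - a x * u x * sin (s' * a x + c x).
  by rewrite partial1of2E; apply: derive_val; exact: dk.
have Gb s' x : `|partial1of2 k s' x| <= G x.
  rewrite d1 (le_trans (ler_normB _ _))// /G lerD// normrM ler_piMr//.
    exact: norm_cos_le1.
  exact: norm_sin_le1.
have dk' s' x : derivable (fun s => k s x) s' 1 by apply: ex_derive; exact: dk.
split.
  exact: (@derivable_under_integral R _ _ mu k setT measurableT s (s - 1) (s + 1) Is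
    (fun s' _ => Lk s') (fun s' x _ _ => dk' s' x) G G0 LG (fun s' x _ _ => Gb s' x)).
have -> := @differentiation_under_integral R _ _ mu k setT measurableT s (s - 1) (s + 1) Is
    (fun s' _ => Lk s') (fun s' x _ _ => dk' s' x) G G0 LG (fun s' x _ _ => Gb s' x).
by apply: eq_Rintegral => x _; rewrite d1.
Qed.

End Real.

Implicit Types F : R -> R[i].

(** A phase that is affine in the parameter s covers both variables of psi: s = x
with a = xi, and s = t with a = eps xi^2. *)
Lemma cintegral_phase_derive F (a c : R -> R) (s : R) :
  cL1 F -> cL1 (fun x => (a x)%:C%C * F x) ->
  measurable_fun setT a -> measurable_fun setT c ->
  cderivable (fun s => cintegral (fun x => F x * expi (s * a x + c x))) s /\
  cderive (fun s => cintegral (fun x => F x * expi (s * a x + c x))) s =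
  'i%C * cintegral (fun x => (a x)%:C%C * F x * expi (s * a x + c x)).
Proof.
move=> [F1 F2] LaF ma mc; have [aF1 aF2] := LaF.
have aR : L1 (fun x => a x * complex.Re (F x)).
  by move: aF1; under eq_fun do rewrite Re_realM.
have aI : L1 (fun x => a x * complex.Im (F x)).
  by move: aF2; under eq_fun do rewrite Im_realM.
have aIN : L1 (fun x => a x * (- complex.Im (F x))).
  by under eq_fun do rewrite mulrN; exact: L1N.
have [d1 e1] := trig_integral_derive F1 (L1N F2) ma mc aR aIN s.
have [d2 e2] := trig_integral_derive F2 F1 ma mc aI aR s.
have E1 : (fun s => complex.Re (cintegral (fun x => F x * expi (s * a x + c x)))) =
    (fun s => \int[mu]_x (complex.Re (F x) * cos (s * a x + c x) +
      - complex.Im (F x) * sin (s * a x + c x))).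
  by apply/funext => z; congr Rintegral; apply/funext => x; rewrite cReM/= mulNr.
have E2 : (fun s => complex.Im (cintegral (fun x => F x * expi (s * a x + c x)))) =
    (fun s => \int[mu]_x (complex.Im (F x) * cos (s * a x + c x) +
      complex.Re (F x) * sin (s * a x + c x))).
  by apply/funext => z; congr Rintegral; apply/funext => x; rewrite cImM/= addrC.
have mph : measurable_fun setT (fun x => s * a x + c x).
  by apply: measurable_funD => //; exact: measurable_funM.
split; first by split; [rewrite E1; exact: d1|rewrite E2; exact: d2].
rewrite /cderive E1 E2 e1 e2 -cintegralZ; last exact: cL1_expi.
apply: complexP; congr Rintegral; apply/funext => x.
  by rewrite !(cReM, cImM, Re_realM, Im_realM)/=; ring.
by rewrite !(cReM, cImM, Re_realM, Im_realM)/=; ring.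
Qed.

Lemma derive1_comb (u v : R -> R) (k l s : R) : derivable u s 1 -> derivable v s 1 ->
  derivable (fun x => k * u x + l * v x) s 1 /\
  derive1 (fun x => k * u x + l * v x) s = k * derive1 u s + l * derive1 v s.
Proof.
move=> du dv; have -> : (fun x => k * u x + l * v x) = k \*: u + l \*: v by [].
have dku : derivable (k \*: u) s 1 by exact: derivableZ.
have dlv : derivable (l \*: v) s 1 by exact: derivableZ.
split; first exact: derivableD.
by rewrite !derive1E (deriveD dku dlv) (deriveZ k du) (deriveZ l dv).
Qed.

Lemma cderiveZ (k : R[i]) F (s : R) : cderivable F s ->
  cderivable (fun x => k * F x) s /\ cderive (fun x => k * F x) s = k * cderive F s.
Proof.
move=> [d1 d2].
have [Dr Er] := derive1_comb (complex.Re k) (- complex.Im k) d1 d2.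
have [Di Ei] := derive1_comb (complex.Re k) (complex.Im k) d2 d1.
have E1 : (fun x => complex.Re (k * F x)) =
  (fun x => complex.Re k * complex.Re (F x) + - complex.Im k * complex.Im (F x)).
  by apply/funext => x; rewrite cReM mulNr.
have E2 : (fun x => complex.Im (k * F x)) =
  (fun x => complex.Re k * complex.Im (F x) + complex.Im k * complex.Re (F x)).
  by apply/funext => x; rewrite cImM.
split; first by split; [rewrite E1; exact: Dr|rewrite E2; exact: Di].
by apply: complexP; rewrite ?cReM ?cImM /cderive ?E1 ?E2 -?mulNr; [exact: Er|exact: Ei].
Qed.

End Differentiation.

(** * The systems psi *)

(** Commutative-ring identity with i, J, k standing for the imaginary unit, i^n and
the normalization; stated in an abstract ring so that [ring] does not unfold
complex numbers. *)
Lemma phase_recurrence (C : comRingType) (i J k b c u v : C) : i * i = -1 ->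
  i * J * k * (i * (b * u + c * v)) = - c * (J * k * v) + b * (i * (i * J) * k * u).
Proof.
move=> ii; have -> : i * J * k * (i * (b * u + c * v)) = (i * i) * (J * k * (b * u + c * v)) by ring.
have -> : i * (i * J) * k * u = (i * i) * (J * k * u) by ring.
rewrite ii; ring.
Qed.
Lemma phase_recurrence0 (C : comRingType) (i k b u : C) :
  k * (i * (b * u)) = b * (i * k * u).
Proof. by ring. Qed.

Lemma normsq_iX (R : realType) n : normsq ('i%C ^+ n : R[i]) = 1.
Proof.
elim: n => [|n IH]; first by rewrite expr0 /normsq /= expr1n expr0n addr0.
by rewrite exprS normsqM IH mulr1 /normsq /= expr1n expr0n add0r.
Qed.

Lemma phase_schroedinger (C : comRingType) (i e k v : C) : i * i = -1 ->
  k * (i * e * v) = - i * e * (k * i * (i * v)).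
Proof.
move=> ii; have -> : - i * e * (k * i * (i * v)) = - (i * i) * (k * (i * e * v)) by ring.
rewrite ii; ring.
Qed.

Lemma orthonormal_factors (C : comRingType) (i1 i2 k1 k2 p1 p2 g1 g2 e1 e2 : C) :
  i1 * k1 * (p1 * g1) * e1 * (i2 * k2 * (p2 * g2) * e2) =
  i1 * i2 * (k1 * k2) * (p1 * p2 * (g1 * g2)) * (e1 * e2).
Proof. by ring. Qed.

Lemma conjM (R : realType) (z u : R[i]) : (z * u)^*%C = z^*%C * u^*%C.
Proof. by apply: complexP; case: z => a b; case: u => c d /=; ring. Qed.

Lemma conj_real (R : realType) (r : R) : (r%:C)^*%C = r%:C%C.
Proof. by apply: complexP; rewrite /= ?oppr0. Qed.

Lemma mul_conj (R : realType) (z : R[i]) : z * z^*%C = (normsq z)%:C%C.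
Proof. by apply: complexP; case: z => a b; rewrite /normsq /=; ring. Qed.

Lemma cintegral_real (R : realType) (r : R -> R) :
  cintegral (fun x => (r x)%:C%C) = (\int[@lebesgue_measure R]_x r x)%:C%C.
Proof. by apply: complexP => //=; rewrite Rintegral_cst// mul0r. Qed.

Lemma lte_double (R : realType) (x y : \bar R) (r s : R) : (x < r%:E)%E -> (y < r%:E)%E ->
  2 * r + 2 * r = s -> (2%:E * x + 2%:E * y < s%:E)%E.
Proof.
move=> xr yr <-; rewrite (_ : (2 * r + 2 * r)%:E = (2%:E * r%:E + 2%:E * r%:E)%E)//.
by rewrite lteD// lte_pmul2l.
Qed.

Section Schroedinger.
Context {R : realType}.
Local Notation mu := (@lebesgue_measure R).
Variables (w : R -> R) (g : R -> R[i]).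
Hypothesis w_moments : forall k : nat, mu.-integrable setT (fun xi => (xi ^+ k * w xi)%:E).
Hypotheses (g_measurable : cmeasurable g) (g_modulus : forall xi, normc (g xi) ^+ 2 = w xi).

Definition polyg (q : {poly R}) (xi : R) : R[i] := (q.[xi])%:C%C * g xi.

Lemma L1_poly_weight (q : {poly R}) : L1 (fun xi => q.[xi] * w xi).
Proof.
have : mu.-integrable setT (fun xi => \sum_(i < size q) (q`_i * (xi ^+ i * w xi))%:E)%E.
  by apply: integrable_sum => // i _; apply: L1Z; exact: w_moments.
apply: eq_integrable => // xi _; rewrite sumEFin /= horner_coef mulr_suml.
by congr EFin; apply: eq_bigr => i _; rewrite mulrA.
Qed.

Lemma measurable_horner (q : {poly R}) : measurable_fun setT (fun xi => q.[xi]).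
Proof. by apply: continuous_measurable_fun; exact: continuous_horner. Qed.

Lemma normsq_polyg q xi : normsq (polyg q xi) = (q ^+ 2).[xi] * w xi.
Proof.
rewrite normsqM (normsq_normc (g xi)) g_modulus; congr (_ * _).
by rewrite /normsq /= expr0n addr0 horner_exp.
Qed.

Lemma cmeasurable_polyg q : cmeasurable (polyg q).
Proof.
apply: cmeasurableM => //; split; last exact: measurable_cst.
exact: measurable_horner.
Qed.

(** From 2 |u| <= 1 / (1 + x^2) + (1 + x^2) u^2: a square-integrable function of
sufficient decay is integrable. *)
Lemma cL1_of_weighted_normsq F : cmeasurable F -> L1 (fun x : R => (1 + x ^+ 2) * normsq (F x)) -> cL1 F.
Proof.
(* [poisson 1] is 1 / (1 + x^2) *)
move=> [m1 m2] LF; have LP := L1_poisson 0 (@ltr01 R).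
have LS := L1D LP LF.
have S0 (x : R) : 0 < 1 + x ^+ 2 by rewrite ltr_pwDl ?sqr_ge0.
have bnd (x u : R) : u ^+ 2 <= normsq (F x) ->
    `|u| <= `|poisson 1 (0 - x) + (1 + x ^+ 2) * normsq (F x)|.
  move=> uF; rewrite [leRHS]ger0_norm; last first.
    by rewrite addr_ge0 ?poisson_ge0// mulr_ge0 ?normsq_ge0 ?ltW.
  rewrite /poisson sub0r sqrrN expr1n div1r.
  apply: (@le_trans _ _ ((1 + x ^+ 2)^-1 + (1 + x ^+ 2) * `|u| ^+ 2)); last first.
    rewrite real_normK ?num_real// lerD2l; apply: ler_wpM2l => //; exact: ltW.
  set S := 1 + x ^+ 2; have S1 : 0 < S := S0 x.
  have q : 0 <= S * (`|u| - S^-1) ^+ 2 by rewrite mulr_ge0 ?sqr_ge0 ?ltW.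
  have qE : S * (`|u| - S^-1) ^+ 2 = S^-1 + S * `|u| ^+ 2 - 2 * `|u|.
    by field; rewrite gt_eqF.
  by rewrite qE in q; have := normr_ge0 u; lra.
split.
  apply: (le_L1 m1 _ LS) => x; apply: bnd; by rewrite /normsq lerDl sqr_ge0.
apply: (le_L1 m2 _ LS) => x; apply: bnd; by rewrite /normsq lerDr sqr_ge0.
Qed.

(** The squared modulus is a polynomial times w, integrable since all moments of w
are finite; the same holds after multiplication by 1 + x^2. *)
Lemma cL1L2_polyg q : cL1L2 (polyg q).
Proof.
split.
  apply: cL1_of_weighted_normsq; first exact: cmeasurable_polyg.
  apply: (eq_L1 _ (L1_poly_weight ((1 + 'X ^+ 2) * q ^+ 2))) => x.
  by rewrite normsq_polyg mulrA !hornerE.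
by under eq_fun do rewrite normsq_polyg; exact: L1_poly_weight.
Qed.

Lemma polygM q r xi : polyg (q * r) xi = (q.[xi])%:C%C * polyg r xi.
Proof. by rewrite /polyg hornerM rmorphM mulrA. Qed.

Variable eps : R.

(** The integral of psi_n without its constant factor, for an arbitrary polynomial
in place of p_n: this family is stable under both derivatives. *)
Definition wave (q : {poly R}) (x t : R) : R[i] :=
  cintegral (fun xi => polyg q xi * expi (x * xi + eps * t * xi ^+ 2)).

Lemma wave_derive_x q x t :
  cderivable (fun z => wave q z t) x /\
  cderive (fun z => wave q z t) x = 'i%C * wave ('X * q) x t.
Proof.
have LX : cL1 (fun xi => xi%:C%C * polyg q xi).
  have [+ _] := cL1L2_polyg ('X * q); congr cL1; apply/funext => xi.
  by rewrite polygM hornerX.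
have mc : measurable_fun setT (fun xi : R => eps * t * xi ^+ 2).
  by apply: measurable_funM => //; exact: measurable_funX.
have [d e] := cintegral_phase_derive x (proj1 (cL1L2_polyg q)) LX (@measurable_id _ _ _) mc.
split; first exact: d.
rewrite [LHS]e; congr (_ * _); apply: eq_cintegral => xi.
by rewrite polygM hornerX.
Qed.

Lemma wave_derive_t q x t :
  cderivable (fun s => wave q x s) t /\
  cderive (fun s => wave q x s) t = 'i%C * eps%:C%C * wave ('X * ('X * q)) x t.
Proof.
have LX : cL1 (fun xi => (eps * xi ^+ 2)%:C%C * polyg q xi).
  have := cL1Z eps%:C%C (proj1 (cL1L2_polyg ('X * ('X * q)))); congr cL1; apply/funext => xi.
  by rewrite !polygM hornerX !rmorphM /= !mulrA.
have ma : measurable_fun setT (fun xi : R => eps * xi ^+ 2).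
  by apply: measurable_funM => //; exact: measurable_funX.
have mc : measurable_fun setT (fun xi : R => x * xi) by exact: measurable_funM.
have [d e] := cintegral_phase_derive t (proj1 (cL1L2_polyg q)) LX ma mc.
have E : (fun s => cintegral (fun xi => polyg q xi * expi (s * (eps * xi ^+ 2) + x * xi)))
    = (fun s => wave q x s).
  apply/funext => s; apply: eq_cintegral => xi; congr (_ * expi _); ring.
rewrite E in d e; split => //.
rewrite e -mulrA; congr (_ * _).
rewrite -cintegralZ; last first.
  apply: cL1_expi; first by case: (cL1L2_polyg ('X * ('X * q))).
  by apply: measurable_funD; apply: measurable_funM => //; exact: measurable_funX.
apply: eq_cintegral => xi.
rewrite [in RHS]mulrA; congr (_ * expi _); last by ring.
by rewrite !polygM hornerX !rmorphM /= !mulrA.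
Qed.

Lemma waveD q r x t : wave (q + r) x t = wave q x t + wave r x t.
Proof.
have mph : measurable_fun setT (fun xi : R => x * xi + eps * t * xi ^+ 2).
  by apply: measurable_funD; apply: measurable_funM => //; exact: measurable_funX.
rewrite /wave -cintegralD; try by apply: cL1_expi => //; exact: (proj1 (cL1L2_polyg _)).
by apply: eq_cintegral => xi; rewrite /polyg hornerD rmorphD !mulrDl.
Qed.

Lemma waveZ (k : R) q x t : wave (k *: q) x t = k%:C%C * wave q x t.
Proof.
have mph : measurable_fun setT (fun xi : R => x * xi + eps * t * xi ^+ 2).
  by apply: measurable_funD; apply: measurable_funM => //; exact: measurable_funX.
rewrite /wave -cintegralZ; last by apply: cL1_expi => //; exact: (proj1 (cL1L2_polyg _)).
by apply: eq_cintegral => xi; rewrite /polyg hornerZ rmorphM !mulrA.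
Qed.


Variables (p : nat -> {poly R}) (b : nat -> R).

Let kappa : R[i] := (Num.sqrt (2 * pi))%:C%C^-1.

Definition amplitude (t : R) (n : nat) (xi : R) : R[i] :=
  'i%C ^+ n * kappa * polyg (p n) xi * expi (eps * t * xi ^+ 2).

Lemma psi_wave n x t : psi p g eps n x t = 'i%C ^+ n * kappa * wave (p n) x t.
Proof. by []. Qed.

Lemma psi0 n x : psi p g eps n x 0 = phi p g n x.
Proof.
congr (_ * _); apply: eq_cintegral => xi.
by rewrite mulr0 mul0r addr0.
Qed.

Lemma measurable_chirp (t : R) : measurable_fun setT (fun xi : R => eps * t * xi ^+ 2).
Proof. by apply: measurable_funM => //; exact: measurable_funX. Qed.

Lemma cL1L2_amplitude t n : cL1L2 (amplitude t n).
Proof.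
by apply: cL1L2_expi (measurable_chirp t); apply: cL1L2Z; exact: cL1L2_polyg.
Qed.

Lemma psi_fourier n x t : psi p g eps n x t = fourier (amplitude t n) x.
Proof.
have mph : measurable_fun setT (fun xi : R => x * xi + eps * t * xi ^+ 2).
  by apply: measurable_funD; [exact: measurable_funM|exact: measurable_chirp].
rewrite psi_wave /wave -cintegralZ; last by apply: cL1_expi => //; exact: (proj1 (cL1L2_polyg _)).
apply: eq_cintegral => xi.
by rewrite addrC expiD /amplitude !mulrA.
Qed.

(** Evolution in time is multiplication by a function of modulus one on the
frequency side. *)
Lemma amplitude_shift s t n xi :
  amplitude (s + t) n xi = amplitude s n xi * expi (eps * t * xi ^+ 2).
Proof. by rewrite /amplitude -[RHS]mulrA -expiD -mulrDl -mulrDr. Qed.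

Hypothesis p_orthonormal : orthonormal_polys w p.
Hypothesis p_recurrence : three_term_recurrence b p.

Lemma psi_derive_x n x t :
  cderivable (fun z => psi p g eps n z t) x /\
  cderive (fun z => psi p g eps n z t) x
    = - (coef_pred b n)%:C%C * psi p g eps n.-1 x t + (b n)%:C%C * psi p g eps n.+1 x t.
Proof.
have [d e] := wave_derive_x (p n) x t.
have [d' e'] := cderiveZ ('i%C ^+ n * kappa) d.
split; first exact: d'.
rewrite [LHS]e' e.
have -> : 'X * p n = b n *: p n.+1 + coef_pred b n *: p n.-1 by rewrite p_recurrence subrK.
rewrite waveD !waveZ !psi_wave; case: n {d e d' e'} => [|n] /=.
  rewrite oppr0 !mul0r addr0 add0r expr0 expr1 !mul1r.
  exact: phase_recurrence0.
rewrite !exprS; apply: phase_recurrence.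
by rewrite -expr2 sqr_i.
Qed.

Lemma psi_derive_t n x t :
  [/\ cderivable (fun s => psi p g eps n x s) t,
      forall y, cderivable (fun z => psi p g eps n z t) y,
      cderivable (cderive (fun z => psi p g eps n z t)) x
    & cderive (fun s => psi p g eps n x s) t
      = - 'i%C * eps%:C%C * cderive (cderive (fun z => psi p g eps n z t)) x].
Proof.
have [dt et] := wave_derive_t (p n) x t.
have [dt' et'] := cderiveZ ('i%C ^+ n * kappa) dt.
have E : cderive (fun z => psi p g eps n z t) =
    (fun z => 'i%C ^+ n * kappa * 'i%C * wave ('X * p n) z t).
  apply/funext => z; have [d e] := wave_derive_x (p n) z t.
  have [d' e'] := cderiveZ ('i%C ^+ n * kappa) d.
  by rewrite [LHS]e' e mulrA.
have [dx ex] := wave_derive_x ('X * p n) x t.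
have [dx' ex'] := cderiveZ ('i%C ^+ n * kappa * 'i%C) dx.
split; [exact: dt'|by move=> y; have [] := psi_derive_x n y t|rewrite E; exact: dx'|].
rewrite [LHS]et' et E ex' ex.
by apply: phase_schroedinger; rewrite -expr2 sqr_i.
Qed.

(** By Parseval this is an integral of p_m p_n |g|^2 = p_m p_n w, the chirps having
modulus one. *)
Lemma psi_orthonormal t m n :
  L2inner (fun x => psi p g eps m x t) (fun x => psi p g eps n x t) = (m == n)%:R.
Proof.
have -> : (fun x => psi p g eps m x t) = fourier (amplitude t m).
  by apply/funext => x; rewrite psi_fourier.
have -> : (fun x => psi p g eps n x t) = fourier (amplitude t n).
  by apply/funext => x; rewrite psi_fourier.
rewrite parseval; [|exact: cL1L2_amplitude..].
have p20 : 0 < 2 * pi :> R by rewrite mulr_gt0// pi_gt0.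
have kk : kappa * kappa^*%C = (2 * pi)%:C%C^-1.
  rewrite mul_conj normsq_normc normcV /normc /= expr0n addr0 sqrtr_sqr.
  by rewrite ger0_norm ?sqrtr_ge0// exprVn sqr_sqrtr ?ltW// fmorphV.
have -> : L2inner (amplitude t m) (amplitude t n) =
    ('i%C ^+ m * ('i%C ^+ n)^*%C * (2 * pi)%:C%C^-1) * (m == n)%:R.
  have -> : ((m == n)%:R : R[i]) =
      cintegral (fun xi => ((p m).[xi] * (p n).[xi] * w xi)%:C%C).
    by rewrite cintegral_real (proj2 p_orthonormal); case: (m == n).
  rewrite -cintegralZ; last first.
    have Lr : L1 (fun xi => (p m).[xi] * (p n).[xi] * w xi).
      by apply: (eq_L1 _ (L1_poly_weight (p m * p n))) => xi; rewrite hornerM.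
    by split; [exact: Lr|exact: integrable0].
  apply: eq_cintegral => xi; rewrite /amplitude /polyg !conjM !conj_real.
  have gg : g xi * (g xi)^*%C = (w xi)%:C%C by rewrite mul_conj normsq_normc g_modulus.
  have ee : expi (eps * t * xi ^+ 2) * (expi (eps * t * xi ^+ 2))^*%C = 1.
    by rewrite mul_conj normsq_expi.
  have -> : ((p m).[xi] * (p n).[xi] * w xi)%:C%C =
    ((p m).[xi])%:C%C * ((p n).[xi])%:C%C * (g xi * (g xi)^*%C) by rewrite gg !rmorphM.
  rewrite -kk -[RHS]mulr1 -ee.
  move: (g xi) (g xi)^*%C (expi _) (expi _)^*%C kappa kappa^*%C => g1 g2 e1 e2 k1 k2.
  move: ('i ^+ m)%C ('i ^+ n)^*%C ((p m).[xi])%:C%C ((p n).[xi])%:C%C => i1 i2 p1 p2.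
  exact: orthonormal_factors.
have [<-|_] := eqVneq m n; last by rewrite !mulr0.
rewrite mulr1 mulrCA mulfV ?mulr1; last by rewrite fmorph_eq0 gt_eqF.
by rewrite mul_conj normsq_iX.
Qed.

Hypothesis phi_basis : orthonormal_basis_L2 (phi p g).

Let linear_psi_fourier (N : nat) (c : nat -> R[i]) t x :
  \sum_(k < N) c k * psi p g eps k x t =
  fourier (fun xi => \sum_(k < N) c k * amplitude t k xi) x.
Proof.
rewrite (@fourier_sum _ N (fun k xi => c k * amplitude t k xi)); last first.
  by move=> k; apply: cL1L2Z; exact: cL1L2_amplitude.
apply: eq_bigr => k _; rewrite psi_fourier fourierZ//.
by case: (cL1L2_amplitude t k).
Qed.

Let approx_psi0 f (e : R) : inL2 f -> 0 < e -> exists (N : nat) (c : nat -> R[i]),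
  (\int[mu]_x (normsq (f x - fourier (fun xi => \sum_(k < N) c k * amplitude 0 k xi) x))%:E
    < (e ^+ 2)%:E)%E.
Proof.
move=> Lf e0; have [_ _ /(_ f Lf e e0) [N [c h]]] := phi_basis.
exists N, c; rewrite -L2norm_lt//; move: h; congr (L2norm _ < _)%E.
apply/funext => x; rewrite -linear_psi_fourier; congr (_ - _).
by apply: eq_bigr => k _; rewrite psi0.
Qed.

(** Completeness at time 0 is used twice: for f, and for the transform of h times
the conjugate chirp, where the transform of h is the first approximation of f. *)
Lemma psi_complete t f (e : R) : inL2 f -> 0 < e -> exists (N : nat) (c : nat -> R[i]),
  (L2norm (fun x => f x - \sum_(k < N) c k * psi p g eps k x t)%R < e%:E)%E.
Proof.
move=> Lf e0; have e20 : 0 < e / 2 by rewrite divr_gt0.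
have cLs s n (c : nat -> R[i]) : cL1L2 (fun xi => \sum_(k < n) c k * amplitude s k xi).
  apply: (@cL1L2_sum _ n (fun k xi => c k * amplitude s k xi)) => k.
  by apply: cL1L2Z; exact: cL1L2_amplitude.
have [N [c hc]] := approx_psi0 Lf e20.
pose h xi := \sum_(k < N) c k * amplitude 0 k xi; have Lh : cL1L2 h by exact: cLs.
have {}hc : (\int[mu]_x (normsq (f x - fourier h x))%:E < ((e / 2) ^+ 2)%:E)%E := hc.
(* the conjugate chirp undoes the evolution up to time t *)
pose h' xi := h xi * expi (eps * - t * xi ^+ 2).
have Lh' : cL1L2 h' by apply: cL1L2_expi => //; exact: measurable_chirp.
have [M [d hd]] := approx_psi0 (inL2_fourier Lh') e20.
pose s xi := \sum_(k < M) d k * amplitude 0 k xi; have Ls : cL1L2 s by exact: cLs.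
have {}hd : (\int[mu]_x (normsq (fourier h' x - fourier s x))%:E < ((e / 2) ^+ 2)%:E)%E := hd.
exists M, d.
pose st xi := \sum_(k < M) d k * amplitude t k xi.
have Lst : cL1L2 st by exact: cLs.
have stE xi : st xi = s xi * expi (eps * t * xi ^+ 2).
  rewrite /st /s mulr_suml; apply: eq_bigr => k _.
  by rewrite -mulrA -amplitude_shift add0r.
have Lhs := cL1L2B Lh Lst; have Lhs' := cL1L2B Lh' Ls.
have hst : (\int[mu]_x (normsq (fourier h x - fourier st x))%:E < ((e / 2) ^+ 2)%:E)%E.
  apply: le_lt_trans hd.
  have E1 : (\int[mu]_x (normsq (fourier h x - fourier st x))%:E =
      \int[mu]_x (normsq (fourier (fun xi => h xi - st xi) x))%:E)%E.
    by apply: eq_integral => x _; rewrite fourierB//; [case: Lh|case: Lst].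
  have E2 : (\int[mu]_x (normsq (fourier h' x - fourier s x))%:E =
      \int[mu]_x (normsq (fourier (fun xi => h' xi - s xi) x))%:E)%E.
    by apply: eq_integral => x _; rewrite fourierB//; [case: Lh'|case: Ls].
  rewrite E1 E2 !plancherel// lee_fin le_eqVlt; apply/orP; left; apply/eqP.
  congr (_ * _); apply: eq_Rintegral => xi _.
  have hE : h' xi * expi (eps * t * xi ^+ 2) = h xi.
    by rewrite /h' -[LHS]mulrA -expiD mulrN mulNr addNr expi0 mulr1.
  by rewrite stE -[RHS]mulr1 -(normsq_expi (eps * t * xi ^+ 2)) -normsqM mulrBl hE.
rewrite L2norm_lt//.
under eq_integral do rewrite linear_psi_fourier -/(st).
have mf : cmeasurable f by case: Lf.
have mh : cmeasurable (fourier h) by apply: cmeasurable_fourier; case: Lh.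
have mst : cmeasurable (fourier st) by apply: cmeasurable_fourier; case: Lst.
have m1 : measurable_fun setT (fun x => normsq (f x - fourier h x)).
  by apply: measurable_normsq; exact: cmeasurableB.
have m2 : measurable_fun setT (fun x => normsq (fourier h x - fourier st x)).
  by apply: measurable_normsq; exact: cmeasurableB.
apply: (@le_lt_trans _ _ (\int[mu]_x (2%:E * (normsq (f x - fourier h x))%:E +
    2%:E * (normsq (fourier h x - fourier st x))%:E))%E).
  apply: ge0_le_integral => //.
  - by move=> x _; rewrite lee_fin normsq_ge0.
  - by apply/measurable_EFinP; apply: measurable_normsq; exact: cmeasurableB.
  - by apply: emeasurable_funD; apply: measurable_funeM; exact/measurable_EFinP.
  - move=> x _; rewrite -!EFinM -EFinD lee_fin.
    rewrite (_ : f x - fourier st x = (f x - fourier h x) + (fourier h x - fourier st x)).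
      exact: normsqD_le.
    by rewrite addrA subrK.
rewrite ge0_integralD//; last 4 first.
- by move=> x _; rewrite -EFinM lee_fin mulr_ge0 ?normsq_ge0.
- by apply: measurable_funeM; exact/measurable_EFinP.
- by move=> x _; rewrite -EFinM lee_fin mulr_ge0 ?normsq_ge0.
- by apply: measurable_funeM; exact/measurable_EFinP.
rewrite !ge0_integralZl//; try by [exact/measurable_EFinP|move=> x _; rewrite lee_fin normsq_ge0].
by apply: (lte_double hc hst); field.
Qed.

Lemma psi_basis t : orthonormal_basis_L2 (fun n x => psi p g eps n x t).
Proof.
split; [|by move=> m n; exact: psi_orthonormal|by move=> f Lf e e0; exact: psi_complete].
move=> n; rewrite (_ : (fun x => _) = fourier (amplitude t n)).
  by apply: inL2_fourier; exact: cL1L2_amplitude.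
by apply/funext => x; rewrite psi_fourier.
Qed.

End Schroedinger.

Theorem theorem4 (R : realType) (w : R -> R) (g : R -> R[i])
  (p : nat -> {poly R}) (b : nat -> R) (eps : R)
  (w_measurable : measurable_fun setT w)
  (w_ge0 : forall xi, 0 <= w xi)
  (w_even : forall xi, w (- xi) = w xi)
  (w_moments : forall k : nat,
     (@lebesgue_measure R).-integrable setT (fun xi => (xi ^+ k * w xi)%:E))
  (p_orthonormal : orthonormal_polys w p)
  (b_gt0 : forall n, 0 < b n)
  (p_recurrence : three_term_recurrence b p)
  (g_measurable : cmeasurable g)
  (g_modulus : forall xi, normc (g xi) ^+ 2 = w xi)
  (phi_basis : orthonormal_basis_L2 (phi p g))
  (eps_gt0 : 0 < eps) :
  [/\ forall n x t,
        [/\ cderivable (fun s => psi p g eps n x s) t,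
            forall y, cderivable (fun z => psi p g eps n z t) y,
            cderivable (cderive (fun z => psi p g eps n z t)) x
          & cderive (fun s => psi p g eps n x s) t
            = - 'i%C * eps%:C%C * cderive (cderive (fun z => psi p g eps n z t)) x],
      forall n x, psi p g eps n x 0 = phi p g n x,
      forall t, orthonormal_basis_L2 (fun n x => psi p g eps n x t)
    & forall n x t,
        cderive (fun z => psi p g eps n z t) x
        = - (coef_pred b n)%:C%C * psi p g eps n.-1 x t
          + (b n)%:C%C * psi p g eps n.+1 x t].
Proof.
split.
- by move=> n x t; exact: (psi_derive_t w_moments).
- by move=> n x; exact: psi0.
- by move=> t; exact: (psi_basis (w := w)).
- by move=> n x t; have [] := psi_derive_x w_moments g_measurable g_modulus eps p_recurrence n x t.
Qed.
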